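(* Let $a,b,c,d\in\mathbb{C}$ with $ad-bc\neq0$ and $|b|=|c|$ be such that $$\varphi(z)=\frac{az+b}{cz+d}$$ is a linear fractional self-map of $\mathbb{D}$ which has a boundary fixed point $\eta\in\mathbb{T}$, i.e. $\varphi(\eta)=\eta$. Let $\psi=K_{\varphi^*(0)}$, where $\varphi^*(z)=\frac{\overline{a}z-\overline{c}}{-\overline{b}z+\overline{d}}$. Let $p\in\mathbb{D}$ be a nonzero point such that $$bp(\overline{p}-1)=c\eta^2\overline{p}(p-1).$$ Then $W_{\psi,\varphi}$ acting on $H^2(\mathbb{D})$ is complex symmetric under the conjugation $\mathcal{J}W_{k_{r},\sigma}$, where $r=p\overline{\eta}$, $$k_{r}(z)=\frac{\sqrt{1-|r|^2}}{1-\overline{r}z},\qquad \sigma(z)=\frac{\overline{r}}{r}\cdot\frac{r-z}{1-\overline{r}z}.$$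
   Context: $\mathbb{D}$ is the open unit disk in $\mathbb{C}$ and $\mathbb{T}$ the unit circle; $H^2(\mathbb{D})$ is the classical Hardy–Hilbert space on $\mathbb{D}$, with reproducing kernel $K_w(z)=1/(1-\overline{w}z)$ at $w\in\mathbb{D}$. For $\psi$ holomorphic on $\mathbb{D}$ and $\varphi$ a holomorphic self-map of $\mathbb{D}$, the weighted composition operator is $W_{\psi,\varphi}f=\psi\cdot(f\circ\varphi)$. A conjugation on a complex Hilbert space is an anti-linear, isometric map $\mathcal{C}$ with $\mathcal{C}^2=I$. A bounded operator $T$ is complex symmetric under the conjugation $\mathcal{C}$ if $\mathcal{C}T=T^*\mathcal{C}$. $\mathcal{J}$ is the conjugation on $H^2(\mathbb{D})$ given by $\mathcal{J}(\sum_{n\ge0}a_nz^n)=\sum_{n\ge0}\overline{a_n}z^n$. *)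

(* Defs.v *)
(* Stdlib reals, with complex numbers and series from Coquelicot. *)
From Stdlib Require Import Reals ClassicalEpsilon.
From Coquelicot Require Import Coquelicot.

Local Open Scope C_scope.

Definition disk (z : C) : Prop := (Cmod z < 1)%R.
Definition circle (z : C) : Prop := Cmod z = 1%R.

(* Functions on the unit disk are represented by functions on [C], of which
   only the values on the disk matter; [eq_disk] is their equality. *)
Definition eq_disk (f g : C -> C) : Prop := forall z, disk z -> f z = g z.

Definition has_expansion (f : C -> C) (a : nat -> C) : Prop :=
  forall z, disk z -> is_pseries a z (f z).

Definition square_summable (a : nat -> C) : Prop :=
  ex_series (fun n => (Cmod (a n) ^ 2)%R).

(* The Hardy-Hilbert space: the functions sum_n a_n z^n (necessarily
   holomorphic on the disk) with sum_n |a_n|^2 finite. *)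
Definition H2 (f : C -> C) : Prop :=
  exists a, square_summable a /\ has_expansion f a.

(* The coefficient sequence, which is unique when it exists; it is meaningful
   only for [f] having a power series expansion on the disk. *)
Definition coef (f : C -> C) : nat -> C :=
  epsilon (inhabits (fun _ : nat => RtoC 0)) (has_expansion f).

(* Total sum of a complex series; meaningful only for convergent series. *)
Definition CSeries (a : nat -> C) : C :=
  (Series (fun n => Re (a n)), Series (fun n => Im (a n))).

Definition inner (f g : C -> C) : C :=
  CSeries (fun n => coef f n * Cconj (coef g n)).

Definition norm2 (f : C -> C) : R :=
  sqrt (Series (fun n => (Cmod (coef f n) ^ 2)%R)).

Definition operator : Type := (C -> C) -> (C -> C).

(* Linearity and boundedness force [T] to respect [eq_disk] on [H2]; the same
   holds for antilinearity and isometry in [conjugation]. *)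
Definition bounded_operator (T : operator) : Prop :=
  (forall f, H2 f -> H2 (T f)) /\
  (forall (alpha : C) f g, H2 f -> H2 g ->
     eq_disk (T (fun z => alpha * f z + g z))
             (fun z => alpha * T f z + T g z)) /\
  (exists M : R, forall f, H2 f -> (norm2 (T f) <= M * norm2 f)%R).

Definition conjugation (A : operator) : Prop :=
  (forall f, H2 f -> H2 (A f)) /\
  (forall (alpha : C) f g, H2 f -> H2 g ->
     eq_disk (A (fun z => alpha * f z + g z))
             (fun z => Cconj alpha * A f z + A g z)) /\
  (forall f, H2 f -> norm2 (A f) = norm2 f) /\
  (forall f, H2 f -> eq_disk (A (A f)) f).

(* [S] is T^*; on [H2] it is determined by [T]. *)
Definition is_adjoint (T S : operator) : Prop :=
  bounded_operator S /\
  (forall f g, H2 f -> H2 g -> inner (T f) g = inner f (S g)).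

Definition complex_symmetric (T A : operator) : Prop :=
  bounded_operator T /\ conjugation A /\
  exists Tstar, is_adjoint T Tstar /\
    forall f, H2 f -> eq_disk (A (T f)) (Tstar (A f)).

Definition W (psi phi : C -> C) : operator := fun f z => psi z * f (phi z).

Definition J : operator :=
  fun f z => CSeries (fun n => Cconj (coef f n) * z ^ n).

Definition kernel (w : C) : C -> C := fun z => 1 / (1 - Cconj w * z).

Definition normalized_kernel (r : C) : C -> C :=
  fun z => RtoC (sqrt (1 - Cmod r ^ 2)) / (1 - Cconj r * z).

Definition sigma_map (r : C) : C -> C :=
  fun z => Cconj r / r * ((r - z) / (1 - Cconj r * z)).

Definition lft (a b c d : C) : C -> C := fun z => (a * z + b) / (c * z + d).

(* Division is total ([x / 0 = 0]), so the absence of poles in the disk is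
   stated explicitly. *)
Definition lft_self_map (a b c d : C) : Prop :=
  forall z, disk z -> c * z + d <> 0 /\ disk (lft a b c d z).

(* Main.v *)
Require Import Defs.
From Stdlib Require Import Reals Lra Lia ClassicalEpsilon FunctionalExtensionality.
From Coquelicot Require Import Coquelicot.

(** Write [phi = lft a b c d] and [T = W psi phi]. Off the pole
    [psi z = d / (c z + d)], so that [T] is the action of the matrix of [phi] on
    functions with the automorphy factor [1 / (c z + d)], and the required
    symmetry is an identity between products of 2x2 matrices. Computing [T] on
    reproducing kernels shows that its adjoint is the operator [S] of the same
    form attached to [phistar]. The conjugation [A] intertwines [T] and [S] as
    soon as [phi o sigma = sigma o phistar~], where [phistar~] is [phistar] with
    conjugated coefficients; for these matrices this amounts to the single equation
    [a |r|^2 + b r = c conj r + d |r|^2], which follows from the fixed point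
    equation [a eta + b = eta (c eta + d)] and the condition on [p]
    ([intertwining_relation], [intertwining]).

    The analytic part is that all these operators act boundedly on the Hardy
    space. Multiplication by a linear fractional self-map [phi] of the disk is a
    contraction: after dividing by the denominator it compares
    [(a z + b) u] with [(c z + d) u] coefficientwise, and what is needed is the
    condition on [a, b, c, d] that expresses [|phi| <= 1] on the circle
    ([H2_le_mult_lft]). If moreover [phi v = 0], Littlewood's argument applies to
    [f -> kernel v * (f o phi)]: by Horner's rule [f = f(0) + z g] the image splits
    into orthogonal pieces, because [phi h] vanishes at [v] and is therefore
    orthogonal to [kernel v] ([subordination_poly]). This bounds the operator on
    polynomials, and completeness of the space of square-summable sequences
    extends the bound ([H2_le_W_of_poly]).

    With [v = r] and [phi = sigma], the constant in the bound makes
    [W k_r sigma] a contraction. As [A] is also an involution, it is isometric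
    ([conjugation_aut]). A general [phi] factors as an automorphism after a
    self-map fixing the origin, to which the same bound applies with [v = 0]
    ([H2_le_W_lft]).

    The adjoint identity [inner (T f) g = inner f (S g)] holds for kernels
    [g = kernel v] by the reproducing property. Expanding in powers of [v]
    identifies [inner f (S z^n)] with the Taylor coefficients of [T f], whence
    the identity for every [g] ([is_adjoint_W]). *)

Local Open Scope R_scope.
Local Open Scope C_scope.

(** * Complex series *)

Lemma sum_n_pair (a : nat -> C) (n : nat) :
  sum_n a n = (sum_n (fun k => Re (a k)) n, sum_n (fun k => Im (a k)) n).
Proof.
  induction n as [|n IH].
  - rewrite !sum_O. apply surjective_pairing.
  - rewrite !sum_Sn, IH. reflexivity.
Qed.

Lemma is_series_Re (a : nat -> C) (l : C) :
  is_series a l -> is_series (fun n => Re (a n)) (Re l).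
Proof.
  intros H. unfold is_series in *.
  apply filterlim_ext with (fun n => fst (sum_n a n)).
  { intros n. rewrite sum_n_pair. reflexivity. }
  apply (filterlim_comp _ _ _ _ _ _ _ _ H).
  destruct l as [x y]. apply continuous_fst.
Qed.

Lemma is_series_Im (a : nat -> C) (l : C) :
  is_series a l -> is_series (fun n => Im (a n)) (Im l).
Proof.
  intros H. unfold is_series in *.
  apply filterlim_ext with (fun n => snd (sum_n a n)).
  { intros n. rewrite sum_n_pair. reflexivity. }
  apply (filterlim_comp _ _ _ _ _ _ _ _ H).
  destruct l as [x y]. apply continuous_snd.
Qed.

Lemma is_series_Re_Im (a : nat -> C) (l : C) :
  is_series (fun n => Re (a n)) (Re l) -> is_series (fun n => Im (a n)) (Im l) ->
  is_series a l.
Proof.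
  intros H1 H2.
  apply filterlim_ext with
    (fun n => (sum_n (fun k => Re (a k)) n, sum_n (fun k => Im (a k)) n)).
  { intros n. rewrite sum_n_pair. reflexivity. }
  eapply filterlim_filter_le_2;
    [|apply (filterlim_pair _ _ H1 H2)].
  { intros P [eps HP]. exists (ball (Re l) eps) (ball (Im l) eps).
    - apply locally_ball.
    - apply locally_ball.
    - intros u v Hu Hv. apply HP. split; assumption. }
Qed.

Lemma CSeries_eq (a : nat -> C) (l : C) : is_series a l -> CSeries a = l.
Proof.
  intros H. unfold CSeries.
  rewrite (is_series_unique _ _ (is_series_Re _ _ H)).
  rewrite (is_series_unique _ _ (is_series_Im _ _ H)).
  destruct l; reflexivity.
Qed.

Lemma is_series_Cunique (a : nat -> C) (l l' : C) :
  is_series a l -> is_series a l' -> l = l'.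
Proof.
  intros H H'. rewrite <- (CSeries_eq _ _ H). apply CSeries_eq, H'.
Qed.

Lemma is_series_Cplus (a b : nat -> C) (l m : C) :
  is_series a l -> is_series b m -> is_series (fun n => a n + b n) (l + m).
Proof. exact (@is_series_plus C_AbsRing C_NormedModule a b l m). Qed.

Lemma is_series_Cscal (k : C) (a : nat -> C) (l : C) :
  is_series a l -> is_series (fun n => k * a n) (k * l).
Proof. exact (@is_series_scal C_AbsRing C_NormedModule k a l). Qed.

Lemma is_series_Rplus (a b : nat -> R) (l m : R) :
  is_series a l -> is_series b m -> is_series (fun n => a n + b n)%R (l + m)%R.
Proof. exact (@is_series_plus R_AbsRing R_NormedModule a b l m). Qed.

Lemma is_series_Rscal (k : R) (a : nat -> R) (l : R) :
  is_series a l -> is_series (fun n => k * a n)%R (k * l)%R.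
Proof. exact (@is_series_scal R_AbsRing R_NormedModule k a l). Qed.

Lemma is_series_Cext (a b : nat -> C) (l : C) :
  (forall n, a n = b n) -> is_series a l -> is_series b l.
Proof. exact (@is_series_ext C_AbsRing C_NormedModule a b l). Qed.

Lemma is_series_Rext (a b : nat -> R) (l : R) :
  (forall n, a n = b n) -> is_series a l -> is_series b l.
Proof. exact (@is_series_ext R_AbsRing R_NormedModule a b l). Qed.

Lemma is_series_Cconj (a : nat -> C) (l : C) :
  is_series a l -> is_series (fun n => Cconj (a n)) (Cconj l).
Proof.
  intros H. apply is_series_Re_Im.
  - exact (is_series_Re _ _ H).
  - apply (is_series_opp _ _ (is_series_Im _ _ H)).
Qed.

Lemma is_series_Rle (a b : nat -> R) (l m : R) :
  (forall n, a n <= b n)%R -> is_series a l -> is_series b m -> (l <= m)%R.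
Proof.
  intros H Ha Hb.
  assert (Rbar_le l m); [|assumption].
  apply (is_lim_seq_le (sum_n a) (sum_n b)); [|exact Ha|exact Hb].
  intros n. apply sum_n_m_le, H.
Qed.

Lemma sum_n_nonneg (u : nat -> R) (n : nat) :
  (forall k, 0 <= u k)%R -> (0 <= sum_n u n)%R.
Proof.
  intros H. induction n as [|n IH].
  - rewrite sum_O. apply H.
  - rewrite sum_Sn. change (0 <= sum_n u n + u (S n))%R. specialize (H (S n)). lra.
Qed.

Lemma is_series_partial_le (u : nat -> R) (s : R) (n : nat) :
  (forall k, 0 <= u k)%R -> is_series u s -> (sum_n u n <= s)%R.
Proof.
  intros H Hs.
  apply (is_lim_seq_incr_compare (sum_n u) s); [exact Hs|].
  intros k. rewrite sum_Sn. change (sum_n u k <= sum_n u k + u (S k))%R.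
  specialize (H (S k)). lra.
Qed.

Lemma is_series_nonneg (u : nat -> R) (s : R) :
  (forall k, 0 <= u k)%R -> is_series u s -> (0 <= s)%R.
Proof.
  intros H Hs. eapply Rle_trans; [|exact (is_series_partial_le u s 0 H Hs)].
  apply sum_n_nonneg, H.
Qed.

Lemma Re_le_Cmod (z : C) : (Re z <= Cmod z)%R.
Proof. eapply Rle_trans; [apply Rle_abs|apply re_le_Cmod]. Qed.

Lemma unimodular_rotation (q : C) : exists z, Cmod z = 1%R /\ Re (q * z) = Cmod q.
Proof.
  destruct (Ceq_dec q 0) as [->|Hq].
  - exists 1. rewrite Cmod_1, Cmod_0. split; [reflexivity|simpl; ring].
  - pose proof (proj1 (Cmod_gt_0 q) Hq) as Hq0.
    assert (Hn : RtoC (Cmod q) <> 0) by (intros E; apply RtoC_inj in E; lra).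
    exists (Cconj q / Cmod q). split.
    + rewrite Cmod_div, Cmod_conj, Cmod_R, Rabs_pos_eq; [field; lra|lra|exact Hn].
    + replace (q * (Cconj q / Cmod q)) with (RtoC (Cmod q)); [reflexivity|].
      transitivity ((q * Cconj q) / Cmod q); [|unfold Cdiv; ring].
      rewrite <- Cmod2_conj, RtoC_pow. field. exact Hn.
Qed.

(** Rotating the sum onto the positive axis turns a bound on the terms into a
    bound on the real part of the rotated sum. *)
Lemma Cmod_is_series_le (a : nat -> C) (b : nat -> R) (l : C) (s : R) :
  (forall n, Cmod (a n) <= b n)%R -> is_series a l -> is_series b s ->
  (Cmod l <= s)%R.
Proof.
  intros H Ha Hb.
  destruct (unimodular_rotation l) as (u & Hu & Hul). rewrite <- Hul, Cmult_comm.
  apply (is_series_Rle (fun n => Re (u * a n)) b); [| |exact Hb].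
  - intros n. eapply Rle_trans; [apply Re_le_Cmod|].
    rewrite Cmod_mult, Hu, Rmult_1_l. apply H.
  - apply is_series_Re, is_series_Cscal, Ha.
Qed.

Lemma ex_series_Cmod (a : nat -> C) (b : nat -> R) :
  (forall n, Cmod (a n) <= b n)%R -> ex_series b -> exists l : C, is_series a l.
Proof.
  intros H Hb.
  apply (@ex_series_le C_AbsRing C_CompleteNormedModule a b); [|exact Hb].
  exact H.
Qed.

(** * Square-summable sequences *)

Definition l2_le (a : nat -> C) (B : R) : Prop :=
  forall n, (sum_n (fun k => Cmod (a k) ^ 2)%R n <= B)%R.

Lemma Cmod_sq_nonneg (z : C) : (0 <= Cmod z ^ 2)%R.
Proof. apply pow2_ge_0. Qed.

Lemma l2_le_series (a : nat -> C) (B : R) :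
  l2_le a B <-> exists s : R, is_series (fun n => Cmod (a n) ^ 2)%R s /\ (s <= B)%R.
Proof.
  split.
  - intros H.
    destruct (ex_finite_lim_seq_incr (sum_n (fun n => Cmod (a n) ^ 2)%R) B) as [s Hs].
    + intros n. rewrite sum_Sn.
      pose proof (Cmod_sq_nonneg (a (S n))).
      change (sum_n (fun n => Cmod (a n) ^ 2)%R n
              <= sum_n (fun n => Cmod (a n) ^ 2)%R n + Cmod (a (S n)) ^ 2)%R. lra.
    + exact H.
    + exists s. split; [exact Hs|].
      assert (Rbar_le s B); [|assumption].
      apply (is_lim_seq_le _ (fun _ => B) _ _ H Hs), is_lim_seq_const.
  - intros (s & Hs & Hle) n. eapply Rle_trans; [|exact Hle].
    apply is_series_partial_le; [intros; apply Cmod_sq_nonneg|exact Hs].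
Qed.

Lemma l2_le_nonneg (a : nat -> C) (B : R) : l2_le a B -> (0 <= B)%R.
Proof.
  intros H. eapply Rle_trans; [|apply (H 0%nat)].
  apply sum_n_nonneg. intros; apply Cmod_sq_nonneg.
Qed.

Lemma l2_le_weaken (a : nat -> C) (B B' : R) : (B <= B')%R -> l2_le a B -> l2_le a B'.
Proof. intros HB H n. eapply Rle_trans; [apply H|exact HB]. Qed.

Lemma l2_le_ext (a b : nat -> C) (B : R) : (forall n, a n = b n) -> l2_le a B -> l2_le b B.
Proof.
  intros E H n. rewrite <- (sum_n_ext (fun k => Cmod (a k) ^ 2)%R); [apply H|].
  intros k. rewrite E. reflexivity.
Qed.

Lemma l2_le_scal (k : C) (a : nat -> C) (B : R) :
  l2_le a B -> l2_le (fun n => k * a n) (Cmod k ^ 2 * B).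
Proof.
  intros (s & Hs & Hle)%l2_le_series. apply l2_le_series.
  exists (Cmod k ^ 2 * s)%R. split.
  - apply is_series_Rext with (fun n => Cmod k ^ 2 * Cmod (a n) ^ 2)%R.
    + intros n. rewrite Cmod_mult. ring.
    + apply is_series_Rscal, Hs.
  - apply Rmult_le_compat_l; [apply Cmod_sq_nonneg|exact Hle].
Qed.

Lemma l2_le_conj (a : nat -> C) (B : R) : l2_le a B -> l2_le (fun n => Cconj (a n)) B.
Proof.
  intros H n. rewrite (sum_n_ext _ (fun k => Cmod (a k) ^ 2)%R); [apply H|].
  intros k. rewrite Cmod_conj. reflexivity.
Qed.

Lemma Cmod_plus_sq (x y : C) : (Cmod (x + y) ^ 2 <= 2 * Cmod x ^ 2 + 2 * Cmod y ^ 2)%R.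
Proof.
  pose proof (Cmod_triangle x y). pose proof (Cmod_ge_0 x). pose proof (Cmod_ge_0 y).
  pose proof (Cmod_ge_0 (x + y)).
  pose proof (pow2_ge_0 (Cmod x - Cmod y)).
  pose proof (pow_incr _ _ 2 (conj H2 H)). lra.
Qed.

Lemma l2_le_plus (a b : nat -> C) (A B : R) :
  l2_le a A -> l2_le b B -> l2_le (fun n => a n + b n) (2 * A + 2 * B).
Proof.
  intros (s & Hs & Hle)%l2_le_series (t & Ht & Hle')%l2_le_series n.
  apply Rle_trans with (sum_n (fun k => 2 * Cmod (a k) ^ 2 + 2 * Cmod (b k) ^ 2)%R n).
  - apply sum_n_m_le. intros k. apply Cmod_plus_sq.
  - eapply Rle_trans; [apply (is_series_partial_le _ (2 * s + 2 * t)%R)|lra].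
    + intros k. pose proof (Cmod_sq_nonneg (a k)). pose proof (Cmod_sq_nonneg (b k)). lra.
    + apply is_series_Rplus; apply is_series_Rscal; assumption.
Qed.

(** Cauchy-Schwarz, from the weighted inequality
    [2 |x| |y| <= t |x|^2 + |y|^2 / t] optimised over [t]. *)
Lemma l2_pairing (a b : nat -> C) (A B : R) :
  l2_le a A -> l2_le b B ->
  exists l : C, is_series (fun n => a n * b n) l /\ (Cmod l ^ 2 <= A * B)%R.
Proof.
  intros Ha Hb.
  pose proof (l2_le_nonneg _ _ Ha) as HA. pose proof (l2_le_nonneg _ _ Hb) as HB.
  apply l2_le_series in Ha, Hb.
  destruct Ha as (s & Hs & HsA), Hb as (t & Ht & HtB).
  assert (Hx : forall x, (0 < x)%R -> forall n,
     (Cmod (a n * b n) <= (x / 2) * Cmod (a n) ^ 2 + (/ x / 2) * Cmod (b n) ^ 2)%R).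
  { intros x Hx n. rewrite Cmod_mult.
    set (u := Cmod (a n)). set (v := Cmod (b n)).
    assert (0 <= (x * u - v) ^ 2 * (/ x / 2))%R.
    { apply Rmult_le_pos; [apply pow2_ge_0|]. apply Rinv_0_lt_compat in Hx. lra. }
    replace ((x * u - v) ^ 2 * (/ x / 2))%R
      with (x / 2 * u ^ 2 + / x / 2 * v ^ 2 - u * v)%R in H by (field; lra).
    lra. }
  assert (Hser : forall x, is_series
      (fun n => (x / 2) * Cmod (a n) ^ 2 + (/ x / 2) * Cmod (b n) ^ 2)%R
      ((x / 2) * s + (/ x / 2) * t)%R).
  { intros x. apply is_series_Rplus; apply is_series_Rscal; assumption. }
  destruct (ex_series_Cmod (fun n => a n * b n) _ (Hx 1%R Rlt_0_1)
              (ex_intro _ _ (Hser 1%R))) as [l Hl].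
  exists l. split; [exact Hl|].
  assert (Hm : forall x, (0 < x -> Cmod l <= (x / 2) * A + (/ x / 2) * B)%R).
  { intros x Hx0. eapply Rle_trans.
    - exact (Cmod_is_series_le _ _ _ _ (Hx x Hx0) Hl (Hser x)).
    - pose proof (Rinv_0_lt_compat _ Hx0). nra. }
  pose proof (Cmod_ge_0 l) as Hl0. set (m := Cmod l) in *.
  destruct (Rle_lt_dec m 0) as [Hm0|Hm0].
  { replace m with 0%R by lra. nra. }
  destruct (Rle_lt_dec A 0) as [HA0|HA0].
  { exfalso. replace A with 0%R in Hm by lra.
    assert (Hx0 : (0 < (B + 1) / m)%R) by (apply Rdiv_lt_0_compat; lra).
    specialize (Hm _ Hx0).
    replace ((B + 1) / m / 2 * 0 + / ((B + 1) / m) / 2 * B)%R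
      with (m * (B / (B + 1)) / 2)%R in Hm by (field; lra).
    assert (B / (B + 1) <= 1)%R.
    { apply Rmult_le_reg_r with (B + 1)%R; [lra|]. field_simplify; lra. }
    nra. }
  specialize (Hm (m / A)%R ltac:(apply Rdiv_lt_0_compat; lra)).
  replace (m / A / 2 * A + / (m / A) / 2 * B)%R with (m / 2 + A * B / m / 2)%R in Hm
    by (field; lra).
  assert (Hm' : (m <= A * B / m)%R) by lra.
  apply (Rmult_le_compat_r m) in Hm'; [|lra].
  replace (A * B / m * m)%R with (A * B)%R in Hm' by (field; lra). lra.
Qed.

(** * Power series on the disk and the Hardy space *)

Lemma has_expansion_series (f : C -> C) (a : nat -> C) :
  has_expansion f a <->
  forall z, disk z -> is_series (fun n => z ^ n * a n) (f z).
Proof. reflexivity. Qed.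

Lemma pseries_Re_radius (a : nat -> R) (g : R -> R) :
  (forall x, (Rabs x < 1)%R -> is_series (fun n => x ^ n * a n)%R (g x)) ->
  Rbar_lt 0 (CV_radius a) /\ forall x, (Rabs x < 1)%R -> PSeries a x = g x.
Proof.
  intros H. split.
  - apply Rbar_lt_le_trans with (Finite (1 / 2)); [simpl; lra|].
    apply Rbar_not_lt_le. intros Hr.
    assert (Hhalf : Rabs (1 / 2) = (1 / 2)%R) by (apply Rabs_pos_eq; lra).
    rewrite <- Hhalf in Hr.
    apply CV_disk_outside in Hr. apply Hr.
    apply ex_series_lim_0.
    apply ex_series_ext with (fun n => (1 / 2) ^ n * a n)%R.
    { intros n. apply Rmult_comm. }
    exists (g (1 / 2)%R). apply H. lra.
  - intros x Hx. apply is_series_unique.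
    apply is_series_Rext with (fun n => x ^ n * a n)%R; [intros; ring|].
    apply H, Hx.
Qed.

(** Restricting to the real diameter turns the real and imaginary parts into
    real power series, whose coefficients are determined by their sums near
    the origin. *)
Lemma has_expansion_unique (f g : C -> C) (a b : nat -> C) :
  eq_disk f g -> has_expansion f a -> has_expansion g b -> forall n, a n = b n.
Proof.
  intros E Ha Hb n.
  assert (Hd : forall x : R, (Rabs x < 1)%R -> disk x).
  { intros x Hx. unfold disk. rewrite Cmod_R. exact Hx. }
  assert (key : forall (P : C -> R),
    (forall (c : nat -> C) l, is_series c l -> is_series (fun k => P (c k)) (P l)) ->
    (forall (x : R) z, P (x * z) = (x * P z)%R) -> P (a n) = P (b n)).
  { intros P Hs Hp.
    assert (Hx : forall c h, has_expansion h c -> forall x, (Rabs x < 1)%R ->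
       is_series (fun k => x ^ k * P (c k))%R (P (h (RtoC x)))).
    { intros c h Hc x Hx.
      apply is_series_Rext with (fun k => P (RtoC x ^ k * c k)).
      - intros k. rewrite <- RtoC_pow. apply Hp.
      - apply Hs, (Hc (RtoC x) (Hd x Hx)). }
    destruct (pseries_Re_radius _ _ (Hx a f Ha)) as [Ra Sa].
    destruct (pseries_Re_radius _ _ (Hx b g Hb)) as [Rb Sb].
    apply (PSeries_ext_recip (fun k => P (a k)) (fun k => P (b k))); [assumption..|].
    exists (mkposreal 1 Rlt_0_1). intros x Hball.
    assert (Hx1 : (Rabs x < 1)%R).
    { replace x with (x - 0)%R by ring. exact Hball. }
    rewrite (Sa x Hx1), (Sb x Hx1), (E (RtoC x) (Hd x Hx1)). reflexivity. }
  apply injective_projections.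
  - apply (key Re is_series_Re). intros x [u v]. simpl. ring.
  - apply (key Im is_series_Im). intros x [u v]. simpl. ring.
Qed.

Lemma coef_eq (f : C -> C) (a : nat -> C) : has_expansion f a -> coef f = a.
Proof.
  intros H. apply functional_extensionality.
  apply (has_expansion_unique f f); [intros z _; reflexivity| |exact H].
  unfold coef. apply epsilon_spec. exists a. exact H.
Qed.

Lemma has_expansion_eq_disk (f g : C -> C) (a : nat -> C) :
  eq_disk f g -> has_expansion f a -> has_expansion g a.
Proof. intros E H z Hz. rewrite <- (E z Hz). apply H, Hz. Qed.

Lemma has_expansion_plus (f g : C -> C) (a b : nat -> C) :
  has_expansion f a -> has_expansion g b ->
  has_expansion (fun z => f z + g z) (fun n => a n + b n).
Proof.
  intros Ha Hb. apply has_expansion_series. intros z Hz.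
  apply has_expansion_series with (z := z) in Ha, Hb; trivial.
  apply is_series_Cext with (fun n => z ^ n * a n + z ^ n * b n); [intros; ring|].
  apply is_series_Cplus; assumption.
Qed.

Lemma has_expansion_scal (k : C) (f : C -> C) (a : nat -> C) :
  has_expansion f a -> has_expansion (fun z => k * f z) (fun n => k * a n).
Proof.
  intros Ha. apply has_expansion_series. intros z Hz.
  apply has_expansion_series with (z := z) in Ha; trivial.
  apply is_series_Cext with (fun n => k * (z ^ n * a n)); [intros; ring|].
  apply is_series_Cscal, Ha.
Qed.

Definition shift (a : nat -> C) (n : nat) : C :=
  match n with O => 0 | S m => a m end.

Lemma is_series_cons (a : nat -> C) (l : C) :
  is_series (fun n => a (S n)) l -> is_series a (a 0%nat + l).
Proof.
  intros H. apply (is_series_decr_1 a).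
  match goal with |- is_series _ ?x => assert (E : x = l) end.
  { change (a 0%nat + l - a 0%nat = l). ring. }
  rewrite E. exact H.
Qed.

Lemma is_series_Rcons (a : nat -> R) (l : R) :
  is_series (fun n => a (S n)) l -> is_series a (a 0%nat + l)%R.
Proof.
  intros H. apply (is_series_decr_1 a).
  match goal with |- is_series _ ?x => assert (E : x = l) end.
  { change (a 0%nat + l - a 0%nat = l)%R. ring. }
  rewrite E. exact H.
Qed.

Lemma has_expansion_shift (f : C -> C) (a : nat -> C) :
  has_expansion f a -> has_expansion (fun z => z * f z) (shift a).
Proof.
  intros Ha. apply has_expansion_series. intros z Hz.
  apply has_expansion_series with (z := z) in Ha; trivial.
  replace (z * f z) with (z ^ 0 * shift a 0 + z * f z) by (simpl; ring).
  apply (is_series_cons (fun n => z ^ n * shift a n)).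
  apply is_series_Cext with (fun n => z * (z ^ n * a n)); [intros; simpl; ring|].
  apply is_series_Cscal, Ha.
Qed.

Lemma l2_shift_series (a : nat -> C) (s : R) :
  is_series (fun n => Cmod (a n) ^ 2)%R s ->
  is_series (fun n => Cmod (shift a n) ^ 2)%R s.
Proof.
  intros H. replace s with (Cmod (shift a 0) ^ 2 + s)%R.
  - apply (is_series_Rcons (fun n => Cmod (shift a n) ^ 2)%R), H.
  - simpl. rewrite Cmod_0. ring.
Qed.

Lemma Csub_nz (x : C) : disk x -> 1 - x <> 0.
Proof.
  intros Hx E. assert (Hx1 : x = 1) by (replace x with (1 - (1 - x)) by ring; rewrite E; ring).
  unfold disk in Hx. rewrite Hx1, Cmod_1 in Hx. lra.
Qed.

Lemma is_series_Cgeom (x : C) : disk x -> is_series (fun n => x ^ n) (1 / (1 - x)).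
Proof.
  intros Hx.
  destruct (ex_series_Cmod (fun n => x ^ n) (fun n => Cmod x ^ n)%R) as [l Hl].
  - intros n. rewrite Cmod_pow. lra.
  - exists (/ (1 - Cmod x))%R. apply is_series_geom.
    rewrite Rabs_pos_eq; [exact Hx|apply Cmod_ge_0].
  - replace (1 / (1 - x)) with l; [exact Hl|].
    pose proof (Csub_nz x Hx) as Hnz.
    assert (El : l = 1 + x * l).
    { apply (is_series_Cunique _ _ _ Hl).
      apply (is_series_cons (fun n => x ^ n)).
      apply is_series_Cext with (fun n => x * x ^ n); [intros; reflexivity|].
      apply is_series_Cscal, Hl. }
    assert (E1 : l * (1 - x) = 1).
    { transitivity (l - x * l); [ring|rewrite El at 1; ring]. }
    transitivity (l * (1 - x) / (1 - x)); [field; exact Hnz|rewrite E1; reflexivity].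
Qed.

Lemma disk_0 : disk 0.
Proof. unfold disk. rewrite Cmod_0. lra. Qed.

Lemma disk_mult (x y : C) : disk x -> disk y -> disk (x * y).
Proof.
  unfold disk. intros Hx Hy. rewrite Cmod_mult.
  pose proof (Cmod_ge_0 x). pose proof (Cmod_ge_0 y). nra.
Qed.

Lemma disk_conj (x : C) : disk x -> disk (Cconj x).
Proof. unfold disk. rewrite Cmod_conj. trivial. Qed.

Lemma kernel_nz (v z : C) : disk v -> disk z -> 1 - Cconj v * z <> 0.
Proof. intros Hv Hz. apply Csub_nz, disk_mult; [apply disk_conj|]; assumption. Qed.

Lemma has_expansion_kernel (v : C) :
  disk v -> has_expansion (kernel v) (fun n => Cconj v ^ n).
Proof.
  intros Hv. apply has_expansion_series. intros z Hz.
  apply is_series_Cext with (fun n => (Cconj v * z) ^ n).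
  - intros n. rewrite Cpow_mult_l. ring.
  - apply is_series_Cgeom, disk_mult; [apply disk_conj|]; assumption.
Qed.

Lemma disk_sq (z : C) : disk z -> (0 < 1 - Cmod z ^ 2)%R.
Proof. unfold disk. intros Hz. pose proof (Cmod_ge_0 z). nra. Qed.

Lemma l2_geom (z : C) :
  disk z -> is_series (fun n => Cmod (z ^ n) ^ 2)%R (/ (1 - Cmod z ^ 2))%R.
Proof.
  intros Hz. apply is_series_Rext with (fun n => (Cmod z ^ 2) ^ n)%R.
  - intros n. rewrite Cmod_pow, <- !pow_mult. f_equal. apply Nat.mul_comm.
  - apply is_series_geom. pose proof (disk_sq z Hz).
    rewrite Rabs_pos_eq; [lra|apply Cmod_sq_nonneg].
Qed.

Lemma l2_le_geom (z : C) : disk z -> l2_le (fun n => z ^ n) (/ (1 - Cmod z ^ 2)).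
Proof.
  intros Hz. apply l2_le_series. eexists. split; [apply l2_geom, Hz|lra].
Qed.

(** Membership in the Hardy space with squared norm at most [B]; bounds on
    operators stated with it compose without mentioning coefficients. *)
Definition H2_le (f : C -> C) (B : R) : Prop :=
  exists a, has_expansion f a /\ l2_le a B.

Lemma H2_H2_le (f : C -> C) : H2 f <-> exists B, H2_le f B.
Proof.
  split.
  - intros (a & (s & Hs) & Ha). exists s, a. split; [exact Ha|].
    apply l2_le_series. exists s. split; [exact Hs|lra].
  - intros (B & a & Ha & (s & Hs & _)%l2_le_series). exists a.
    split; [exists s; exact Hs|exact Ha].
Qed.

Lemma H2_le_coef (f : C -> C) (B : R) :
  H2_le f B <-> has_expansion f (coef f) /\ l2_le (coef f) B.
Proof.
  split.
  - intros (a & Ha & Hl). rewrite (coef_eq f a Ha). split; assumption.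
  - intros H. exists (coef f). exact H.
Qed.

Lemma H2_le_weaken (f : C -> C) (B B' : R) : (B <= B')%R -> H2_le f B -> H2_le f B'.
Proof. intros HB (a & Ha & Hl). exists a. split; [exact Ha|exact (l2_le_weaken _ _ _ HB Hl)]. Qed.

Lemma H2_le_eq_disk (f g : C -> C) (B : R) : eq_disk f g -> H2_le f B -> H2_le g B.
Proof.
  intros E (a & Ha & Hl). exists a. split; [exact (has_expansion_eq_disk _ _ _ E Ha)|exact Hl].
Qed.

Lemma H2_le_scal (k : C) (f : C -> C) (B : R) :
  H2_le f B -> H2_le (fun z => k * f z) (Cmod k ^ 2 * B).
Proof.
  intros (a & Ha & Hl). exists (fun n => k * a n).
  split; [apply has_expansion_scal, Ha|apply l2_le_scal, Hl].
Qed.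

Lemma H2_le_plus (f g : C -> C) (A B : R) :
  H2_le f A -> H2_le g B -> H2_le (fun z => f z + g z) (2 * A + 2 * B).
Proof.
  intros (a & Ha & Hl) (b & Hb & Hl'). exists (fun n => a n + b n).
  split; [apply has_expansion_plus|apply l2_le_plus]; assumption.
Qed.

Lemma H2_lincomb (k : C) (f g : C -> C) :
  H2 f -> H2 g -> H2 (fun z => k * f z + g z).
Proof.
  intros (A & HA)%H2_H2_le (B & HB)%H2_H2_le. apply H2_H2_le.
  eexists. apply (H2_le_plus (fun z => k * f z)); [apply H2_le_scal, HA|exact HB].
Qed.

Lemma H2_kernel (v : C) : disk v -> H2 (kernel v).
Proof.
  intros Hv. apply H2_H2_le. exists (/ (1 - Cmod (Cconj v) ^ 2))%R, (fun n => Cconj v ^ n).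
  split; [apply has_expansion_kernel, Hv|apply l2_le_geom, disk_conj, Hv].
Qed.

Lemma l2_le_pseries (a : nat -> C) (B : R) (z : C) :
  l2_le a B -> disk z ->
  exists l : C, is_series (fun n => z ^ n * a n) l /\ (Cmod l ^ 2 <= / (1 - Cmod z ^ 2) * B)%R.
Proof.
  intros Ha Hz. apply (l2_pairing (fun n => z ^ n) a); [apply l2_le_geom, Hz|exact Ha].
Qed.

Lemma H2_le_eval (f : C -> C) (B : R) (z : C) :
  H2_le f B -> disk z -> (Cmod (f z) ^ 2 <= / (1 - Cmod z ^ 2) * B)%R.
Proof.
  intros (a & Ha & Hl) Hz. destruct (l2_le_pseries a B z Hl Hz) as (l & Hs & Hle).
  rewrite (is_series_Cunique _ _ _ (Ha z Hz) Hs). exact Hle.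
Qed.

Lemma l2_le_function (a : nat -> C) (B : R) :
  l2_le a B -> has_expansion (fun z => CSeries (fun n => z ^ n * a n)) a.
Proof.
  intros Ha. apply has_expansion_series. intros z Hz.
  destruct (l2_le_pseries a B z Ha Hz) as (l & Hs & _).
  rewrite (CSeries_eq _ _ Hs). exact Hs.
Qed.

Lemma norm2_H2_le (f : C -> C) : H2 f -> H2_le f (norm2 f ^ 2).
Proof.
  intros (B & HB)%H2_H2_le.
  pose proof (H2_le_coef f B) as [Hc _]. destruct (Hc HB) as [Ha Hl].
  apply l2_le_series in Hl as (s & Hs & _).
  assert (Hs0 : (0 <= s)%R).
  { apply (is_series_nonneg _ _ (fun n => Cmod_sq_nonneg (coef f n)) Hs). }
  exists (coef f). split; [exact Ha|]. apply l2_le_series. exists s. split; [exact Hs|].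
  unfold norm2. rewrite (is_series_unique _ _ Hs), pow2_sqrt; lra.
Qed.

Lemma norm2_le (f : C -> C) (m : R) : (0 <= m)%R -> H2_le f (m ^ 2) -> (norm2 f <= m)%R.
Proof.
  intros Hm (Ha & Hl)%H2_le_coef. apply l2_le_series in Hl as (s & Hs & Hle).
  unfold norm2. rewrite (is_series_unique _ _ Hs).
  rewrite <- (sqrt_pow2 m Hm). apply sqrt_le_1_alt, Hle.
Qed.

Lemma norm2_nonneg (f : C -> C) : (0 <= norm2 f)%R.
Proof. apply sqrt_pos. Qed.

Lemma inner_eq (f g : C -> C) (a b : nat -> C) (l : C) :
  has_expansion f a -> has_expansion g b ->
  is_series (fun n => a n * Cconj (b n)) l -> inner f g = l.
Proof.
  intros Ha Hb Hl. unfold inner. rewrite (coef_eq f a Ha), (coef_eq g b Hb).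
  apply CSeries_eq, Hl.
Qed.

Lemma H2_inner_series (f g : C -> C) (A B : R) :
  H2_le f A -> H2_le g B ->
  is_series (fun n => coef f n * Cconj (coef g n)) (inner f g)
  /\ (Cmod (inner f g) ^ 2 <= A * B)%R.
Proof.
  intros (Hf & Hl)%H2_le_coef (Hg & Hl')%H2_le_coef.
  destruct (l2_pairing (coef f) (fun n => Cconj (coef g n)) A B Hl (l2_le_conj _ _ Hl'))
    as (l & Hs & Hle).
  rewrite (inner_eq f g _ _ l Hf Hg Hs). split; assumption.
Qed.

(** * Multiplication by linear fractional maps *)

Lemma linear_nz (c d z : C) : (Cmod c < Cmod d)%R -> (Cmod z <= 1)%R -> c * z + d <> 0.
Proof.
  intros Hcd Hz E.
  assert (Ed : d = - (c * z)) by (replace d with (c * z + d - c * z) by ring; rewrite E; ring).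
  rewrite Ed, Cmod_opp, Cmod_mult in Hcd.
  pose proof (Cmod_ge_0 c). pose proof (Cmod_ge_0 z). nra.
Qed.

(** Solving [(c z + d) u = g] for the coefficients of [u] from the constant
    term upwards; convexity of the square, with weights [|d| - |c|] and [|c|],
    makes the recursion telescope. *)
Lemma H2_le_div_linear (c d : C) (g : C -> C) (B : R) :
  (Cmod c < Cmod d)%R -> H2_le g B ->
  H2_le (fun z => g z / (c * z + d)) (B / (Cmod d - Cmod c) ^ 2).
Proof.
  intros Hcd (a & Ha & Hl).
  pose proof (Cmod_ge_0 c) as Hc0. set (e := (Cmod d - Cmod c)%R).
  assert (He : (0 < e)%R) by (unfold e; lra).
  assert (Hd : d <> 0) by (apply Cmod_gt_0; lra).
  set (u := fix u (n : nat) : C :=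
       match n with O => a O / d | S m => (a (S m) - c * u m) / d end).
  assert (Hu : forall n, c * shift u n + d * u n = a n).
  { intros [|n]; simpl; field; exact Hd. }
  assert (Hstep : forall n,
    ((e + Cmod c) * Cmod (u n) ^ 2 <= Cmod (a n) ^ 2 / e + Cmod c * Cmod (shift u n) ^ 2)%R).
  { intros n.
    set (x := Cmod (u n)). set (y := Cmod (shift u n)). set (g0 := Cmod (a n)).
    assert (Hx : ((e + Cmod c) * x <= g0 + Cmod c * y)%R).
    { unfold x, y, g0, e.
      replace (Cmod d - Cmod c + Cmod c)%R with (Cmod d) by ring.
      rewrite <- !Cmod_mult.
      replace (d * u n) with (a n + - (c * shift u n)) by (rewrite <- (Hu n); ring).
      eapply Rle_trans; [apply Cmod_triangle|]. rewrite Cmod_opp. lra. }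
    assert (Hx0 : (0 <= x)%R) by apply Cmod_ge_0.
    assert (Hsq : ((g0 + Cmod c * y) ^ 2 <= (e + Cmod c) * (g0 ^ 2 / e + Cmod c * y ^ 2))%R).
    { assert (0 <= Cmod c * (g0 - e * y) ^ 2 / e)%R.
      { apply Rmult_le_pos; [apply Rmult_le_pos; [lra|apply pow2_ge_0]|].
        left. apply Rinv_0_lt_compat, He. }
      replace (Cmod c * (g0 - e * y) ^ 2 / e)%R
        with ((e + Cmod c) * (g0 ^ 2 / e + Cmod c * y ^ 2) - (g0 + Cmod c * y) ^ 2)%R in H
        by (field; lra).
      lra. }
    assert (Hx2 : (((e + Cmod c) * x) ^ 2 <= (g0 + Cmod c * y) ^ 2)%R).
    { apply pow_incr. split; [|exact Hx]. apply Rmult_le_pos; lra. }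
    apply Rmult_le_reg_l with (e + Cmod c)%R; [lra|].
    eapply Rle_trans; [|exact Hsq]. eapply Rle_trans; [|exact Hx2]. right. ring. }
  assert (Hsum : forall n,
    (e * sum_n (fun k => Cmod (u k) ^ 2)%R n + Cmod c * Cmod (u n) ^ 2
     <= sum_n (fun k => Cmod (a k) ^ 2)%R n / e)%R).
  { induction n as [|n IH].
    - rewrite !sum_O. specialize (Hstep 0%nat). simpl shift in Hstep.
      rewrite Cmod_0 in Hstep. lra.
    - rewrite !sum_Sn. specialize (Hstep (S n)). simpl shift in Hstep.
      change (e * (sum_n (fun k => Cmod (u k) ^ 2)%R n + Cmod (u (S n)) ^ 2)
              + Cmod c * Cmod (u (S n)) ^ 2
              <= (sum_n (fun k => Cmod (a k) ^ 2)%R n + Cmod (a (S n)) ^ 2) / e)%R.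
      unfold Rdiv in *. lra. }
  assert (Hul : l2_le u (B / e ^ 2)).
  { intros n. specialize (Hsum n). specialize (Hl n).
    pose proof (Cmod_sq_nonneg (u n)).
    apply Rmult_le_reg_l with e; [exact He|].
    replace (e * (B / e ^ 2))%R with (B * / e)%R by (field; lra).
    pose proof (Rinv_0_lt_compat _ He). unfold Rdiv in Hsum. nra. }
  exists u. split; [|exact Hul].
  pose proof (l2_le_function u _ Hul) as HU.
  set (U := fun z => CSeries (fun n => z ^ n * u n)) in HU.
  apply has_expansion_eq_disk with U; [|exact HU].
  intros z Hz.
  assert (HG : has_expansion (fun z => c * (z * U z) + d * U z) a).
  { assert (Ea : a = fun n => c * shift u n + d * u n).
    { apply functional_extensionality. intros n. symmetry. apply Hu. }
    rewrite Ea. apply (has_expansion_plus (fun z => c * (z * U z)) (fun z => d * U z)).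
    - apply has_expansion_scal with (f := fun z => z * U z), has_expansion_shift, HU.
    - apply has_expansion_scal, HU. }
  rewrite (is_series_Cunique _ _ _ (Ha z Hz) (HG z Hz)).
  field. apply linear_nz; [exact Hcd|]. unfold disk in Hz. lra.
Qed.

Lemma Cmod_linear_sq (c d x y : C) :
  (Cmod (c * x + d * y) ^ 2 = Cmod c ^ 2 * Cmod x ^ 2 + Cmod d ^ 2 * Cmod y ^ 2
     + 2 * Re (c * Cconj d * (x * Cconj y)))%R.
Proof.
  rewrite !Cmod2_alt. destruct c, d, x, y. simpl. ring.
Qed.

(** The condition on the coefficients expressing that [z -> (a z + b) / (c z + d)]
    is holomorphic and bounded by [1] on the closed disk: on the circle,
    [|c z + d|^2 - |a z + b|^2 = |c|^2 + |d|^2 - |a|^2 - |b|^2 - 2 Re ((a conj b - c conj d) z)]. *)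
Definition lft_contractive (a b c d : C) : Prop :=
  (Cmod c < Cmod d /\
   Cmod a ^ 2 + Cmod b ^ 2 + 2 * Cmod (a * Cconj b - c * Cconj d)
     <= Cmod c ^ 2 + Cmod d ^ 2)%R.

Lemma linear_sq_compare (a b c d x y : C) :
  (Cmod (a * x + b * y) ^ 2 <= Cmod (c * x + d * y) ^ 2
     + (Cmod a ^ 2 - Cmod c ^ 2 + Cmod (a * Cconj b - c * Cconj d)) * Cmod x ^ 2
     + (Cmod b ^ 2 - Cmod d ^ 2 + Cmod (a * Cconj b - c * Cconj d)) * Cmod y ^ 2)%R.
Proof.
  rewrite !Cmod_linear_sq.
  assert (H : (Re (a * Cconj b * (x * Cconj y)) - Re (c * Cconj d * (x * Cconj y))
    <= Cmod (a * Cconj b - c * Cconj d) * (Cmod x * Cmod y))%R).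
  { rewrite <- (Cmod_conj y), <- !Cmod_mult.
    eapply Rle_trans; [|apply Re_le_Cmod]. right.
    destruct a, b, c, d, x, y. simpl. ring. }
  pose proof (Cmod_ge_0 (a * Cconj b - c * Cconj d)) as Hm.
  set (m := Cmod (a * Cconj b - c * Cconj d)) in *.
  pose proof (pow2_ge_0 (Cmod x - Cmod y)). nra.
Qed.

(** Writing [g = (c z + d) u], the claim compares [(a z + b) u] with
    [(c z + d) u]; in both squared norms the cross term is the same inner
    product of [z u] and [u], which is at most the squared norm of [u]. *)
Lemma H2_le_mult_lft (a b c d : C) (g : C -> C) (B : R) :
  lft_contractive a b c d -> H2_le g B -> H2_le (fun z => lft a b c d z * g z) B.
Proof.
  intros [Hcd Hm] Hg.
  destruct (H2_le_div_linear c d g B Hcd Hg) as (u & HU & Hu).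
  destruct Hg as (gs & Hgs & Hl).
  set (U := fun z => g z / (c * z + d)) in HU.
  assert (Hlin : forall p q, has_expansion (fun z => p * (z * U z) + q * U z)
                               (fun n => p * shift u n + q * u n)).
  { intros p q. apply (has_expansion_plus (fun z => p * (z * U z)) (fun z => q * U z)).
    - apply has_expansion_scal with (f := fun z => z * U z), has_expansion_shift, HU.
    - apply has_expansion_scal, HU. }
  assert (Hnz : forall z, disk z -> c * z + d <> 0).
  { intros z Hz. apply linear_nz; [exact Hcd|]. unfold disk in Hz. lra. }
  exists (fun n => a * shift u n + b * u n). split.
  { apply (has_expansion_eq_disk (fun z => a * (z * U z) + b * U z)); [|apply Hlin].
    intros z Hz. unfold U, lft. field. apply Hnz, Hz. }
  assert (Eg : forall n, gs n = c * shift u n + d * u n).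
  { apply (has_expansion_unique g (fun z => c * (z * U z) + d * U z)); [|exact Hgs|apply Hlin].
    intros z Hz. unfold U. field. apply Hnz, Hz. }
  apply l2_le_series in Hl as (sg & Hsg & HsgB).
  assert (Hu' := Hu). apply l2_le_series in Hu' as (s & Hs & _).
  assert (Hs' := l2_shift_series u s Hs).
  assert (Hss : l2_le (shift u) s) by (apply l2_le_series; exists s; split; [exact Hs'|lra]).
  destruct (proj1 (l2_le_series _ _)
     (l2_le_plus _ _ _ _ (l2_le_scal a _ _ Hss) (l2_le_scal b _ _ Hu))) as (t & Ht & _).
  apply l2_le_series. exists t. split; [exact Ht|].
  eapply Rle_trans; [|exact HsgB].
  set (m := Cmod (a * Cconj b - c * Cconj d)) in *.
  apply Rle_trans with
    (sg + (Cmod a ^ 2 - Cmod c ^ 2 + m) * s + (Cmod b ^ 2 - Cmod d ^ 2 + m) * s)%R.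
  - apply (is_series_Rle _ (fun n => Cmod (gs n) ^ 2
       + (Cmod a ^ 2 - Cmod c ^ 2 + m) * Cmod (shift u n) ^ 2
       + (Cmod b ^ 2 - Cmod d ^ 2 + m) * Cmod (u n) ^ 2)%R _ _) with (2 := Ht).
    + intros n. rewrite Eg. apply linear_sq_compare.
    + repeat apply is_series_Rplus; [exact Hsg|apply is_series_Rscal, Hs'|apply is_series_Rscal, Hs].
  - assert (0 <= s)%R by exact (is_series_nonneg _ _ (fun n => Cmod_sq_nonneg (u n)) Hs).
    nra.
Qed.

Lemma quadratic_nonneg_at_1 (A B D : R) :
  (forall t, 0 <= t < 1 -> 0 <= A * t ^ 2 + B * t + D)%R -> (0 <= A + B + D)%R.
Proof.
  intros H. destruct (Rle_lt_dec 0 (A + B + D)) as [|Hneg]; [assumption|exfalso].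
  set (e := (- (A + B + D))%R). set (K := (Rabs (2 * A + B) + Rabs A)%R).
  assert (HK : (0 <= K)%R) by (unfold K; pose proof (Rabs_pos (2 * A + B)); pose proof (Rabs_pos A); lra).
  assert (He : (0 < e)%R) by (unfold e; lra).
  (* at [t = 1 - x] the value is at most [- e + x K], which is still negative *)
  set (x := (e / (2 * (K + e)))%R).
  assert (Hx : (x * (2 * (K + e)) = e)%R) by (unfold x; field; lra).
  assert (Hx0 : (0 < x)%R) by (apply Rdiv_lt_0_compat; lra).
  assert (Hx1 : (x <= 1 / 2)%R) by nra.
  specialize (H (1 - x)%R ltac:(lra)).
  assert (H1 : (- (2 * A + B) <= Rabs (2 * A + B))%R) by (rewrite <- Rabs_Ropp; apply Rle_abs).
  pose proof (Rle_abs A) as H2.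
  replace (A * (1 - x) ^ 2 + B * (1 - x) + D)%R
    with (- e + x * (- (2 * A + B)) + (x * x) * A)%R in H by (unfold e; ring).
  assert (x * - (2 * A + B) <= x * Rabs (2 * A + B))%R by (apply Rmult_le_compat_l; lra).
  assert (x * x * A <= x * Rabs A)%R.
  { pose proof (Rabs_pos A).
    assert (x * A <= 1 * Rabs A)%R.
    { eapply Rle_trans; [apply Rmult_le_compat_l; [lra|exact H2]|].
      apply Rmult_le_compat_r; lra. }
    rewrite Rmult_assoc. apply Rmult_le_compat_l; lra. }
  unfold K in *. nra.
Qed.

(** Radial limits extend the bound [|a z + b| <= |c z + d|] to the closed disk. *)
Lemma lft_self_map_closed (a b c d z : C) :
  lft_self_map a b c d -> (Cmod z <= 1)%R ->
  (Cmod (a * z + b) ^ 2 <= Cmod (c * z + d) ^ 2)%R.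
Proof.
  intros Hself Hz.
  assert (E : forall p q (t : R), (Cmod (p * (t * z) + q) ^ 2
     = Cmod p ^ 2 * Cmod z ^ 2 * t ^ 2 + 2 * Re (p * Cconj q * z) * t + Cmod q ^ 2)%R).
  { intros p q t. rewrite !Cmod2_alt. destruct p, q, z. simpl. ring. }
  assert (E1 : forall p q, Cmod (p * z + q) = Cmod (p * (1%R * z) + q)).
  { intros p q. f_equal. ring. }
  rewrite (E1 a b), (E1 c d), !E.
  enough (0 <= (Cmod c ^ 2 * Cmod z ^ 2 - Cmod a ^ 2 * Cmod z ^ 2)
     + (2 * Re (c * Cconj d * z) - 2 * Re (a * Cconj b * z))
     + (Cmod d ^ 2 - Cmod b ^ 2))%R by lra.
  apply quadratic_nonneg_at_1. intros t Ht.
  assert (Htz : disk (t * z)).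
  { unfold disk. rewrite Cmod_mult, Cmod_R, Rabs_pos_eq; [|lra].
    pose proof (Cmod_ge_0 z). nra. }
  destruct (Hself _ Htz) as [Hnz Hlt]. unfold disk, lft in Hlt.
  rewrite Cmod_div in Hlt; [|exact Hnz].
  pose proof (proj1 (Cmod_gt_0 _) Hnz) as Hpos.
  assert (Hle : (Cmod (a * (t * z) + b) <= Cmod (c * (t * z) + d))%R).
  { apply (Rmult_lt_compat_r _ _ _ Hpos) in Hlt.
    unfold Rdiv in Hlt. rewrite Rmult_assoc, Rinv_l in Hlt; lra. }
  pose proof (pow_incr _ _ 2 (conj (Cmod_ge_0 _) Hle)) as Hsq.
  rewrite !E in Hsq. lra.
Qed.

Lemma lft_self_map_contractive (a b c d : C) :
  a * d - b * c <> 0 -> lft_self_map a b c d -> lft_contractive a b c d.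
Proof.
  intros Hdet Hself. split.
  - destruct (Rlt_le_dec (Cmod c) (Cmod d)) as [|Hle]; [assumption|exfalso].
    destruct (Hself 0 disk_0) as [Hd _].
    assert (Hd' : d <> 0) by (intros E; apply Hd; rewrite E; ring).
    apply Cmod_gt_0 in Hd'.
    assert (Hc : c <> 0) by (apply Cmod_gt_0; lra).
    (* the pole [- d / c] would lie in the closed disk *)
    assert (Hz : (Cmod (- d / c) <= 1)%R).
    { rewrite Cmod_div, Cmod_opp; [|exact Hc].
      apply Rmult_le_reg_r with (Cmod c); [lra|]. field_simplify; lra. }
    pose proof (lft_self_map_closed a b c d (- d / c) Hself Hz) as H.
    replace (c * (- d / c) + d) with (RtoC 0) in H by (field; exact Hc).
    rewrite Cmod_0 in H.
    assert (E : a * (- d / c) + b = 0).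
    { apply Cmod_eq_0. pose proof (Cmod_ge_0 (a * (- d / c) + b)). nra. }
    apply Hdet. replace (a * d - b * c) with (- c * (a * (- d / c) + b)) by (field; exact Hc).
    rewrite E. ring.
  - destruct (unimodular_rotation (a * Cconj b - c * Cconj d)) as (z & Hz & Hq).
    pose proof (lft_self_map_closed a b c d z Hself ltac:(lra)) as H.
    assert (E : forall p q, (Cmod (p * z + q) ^ 2
       = Cmod p ^ 2 + Cmod q ^ 2 + 2 * Re (p * Cconj q * z))%R).
    { intros p q. replace (p * z + q) with (p * z + q * 1) by ring.
      rewrite Cmod_linear_sq, Hz, Cmod_1.
      replace (p * Cconj q * (z * Cconj 1)) with (p * Cconj q * z); [ring|].
      unfold Cconj. simpl. destruct p, q, z. unfold Cmult. simpl. f_equal; ring. }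
    rewrite !E in H. rewrite <- Hq.
    replace (Re ((a * Cconj b - c * Cconj d) * z))
      with (Re (a * Cconj b * z) - Re (c * Cconj d * z))%R; [lra|].
    destruct a, b, c, d, z. simpl. ring.
Qed.

(** If the adjoint map sent a point [w] of the disk outside it, then
    [c z + d = conj w (a z + b)] would have a solution [z] in the closed disk,
    against [|a z + b| <= |c z + d|]. *)
Lemma lft_self_map_adjoint (a b c d : C) :
  a * d - b * c <> 0 -> lft_self_map a b c d ->
  lft_self_map (Cconj a) (- Cconj c) (- Cconj b) (Cconj d).
Proof.
  intros Hdet Hself w Hw.
  destruct (lft_self_map_contractive a b c d Hdet Hself) as [Hcd _].
  assert (H0 : (Cmod 0 <= 1)%R) by (rewrite Cmod_0; lra).
  pose proof (lft_self_map_closed a b c d 0 Hself H0) as Hbd.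
  replace (a * 0 + b) with b in Hbd by ring. replace (c * 0 + d) with d in Hbd by ring.
  pose proof (Cmod_ge_0 b) as Hb0. pose proof (Cmod_ge_0 c) as Hc0.
  pose proof (Cmod_ge_0 w) as Hw0. unfold disk in Hw.
  assert (Hbd' : (Cmod b <= Cmod d)%R) by nra.
  assert (Hnz : - Cconj b * w + Cconj d <> 0).
  { intros E.
    assert (Ed : Cmod d = (Cmod b * Cmod w)%R).
    { rewrite <- (Cmod_conj d), <- (Cmod_conj b), <- Cmod_mult. f_equal.
      transitivity (- Cconj b * w + Cconj d + Cconj b * w); [ring|]. rewrite E. ring. }
    nra. }
  split; [exact Hnz|].
  unfold disk, lft. rewrite Cmod_div; [|exact Hnz].
  pose proof (proj1 (Cmod_gt_0 _) Hnz) as Hpos.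
  destruct (Rlt_le_dec (Cmod (Cconj a * w + - Cconj c)) (Cmod (- Cconj b * w + Cconj d)))
    as [Hlt|Hge].
  { apply Rmult_lt_reg_r with (Cmod (- Cconj b * w + Cconj d)); [exact Hpos|].
    unfold Rdiv. rewrite Rmult_assoc, Rinv_l; lra. }
  exfalso.
  set (num := Cconj a * w + - Cconj c) in *. set (den := - Cconj b * w + Cconj d) in *.
  assert (Hnum : Cconj num <> 0) by (apply Cmod_gt_0; rewrite Cmod_conj; lra).
  set (z := Cconj den / Cconj num).
  assert (Hz : (Cmod z <= 1)%R).
  { unfold z. rewrite Cmod_div, !Cmod_conj; [|exact Hnum].
    apply Rmult_le_reg_r with (Cmod num); [lra|]. field_simplify; lra. }
  assert (E : c * z + d = Cconj w * (a * z + b)).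
  { assert (Ez : z * Cconj num = Cconj den) by (unfold z; field; exact Hnum).
    unfold num, den in Ez.
    rewrite !Cplus_conj, !Copp_conj, !Cmult_conj, !Copp_conj, !Cconj_conj in Ez.
    transitivity (c * z + (- b * Cconj w + d) + b * Cconj w); [ring|].
    rewrite <- Ez. ring. }
  pose proof (lft_self_map_closed a b c d z Hself Hz) as H.
  pose proof (linear_nz c d z Hcd Hz) as Hl. apply Cmod_gt_0 in Hl.
  assert (Ew : Cmod (c * z + d) = (Cmod w * Cmod (a * z + b))%R).
  { rewrite E, Cmod_mult, Cmod_conj. reflexivity. }
  pose proof (Cmod_ge_0 (a * z + b)).
  assert (Cmod (a * z + b) <= Cmod (c * z + d))%R by nra.
  nra.
Qed.

(** * Polynomials and density *)

Definition poly (a : nat -> C) (N : nat) (z : C) : C := sum_n (fun n => a n * z ^ n) N.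

Definition trunc (a : nat -> C) (N n : nat) : C := if (n <=? N)%nat then a n else 0.

Definition tail (a : nat -> C) (N n : nat) : C := a n - trunc a N n.

Lemma sum_n_finite {G : AbelianMonoid} (u : nat -> G) (N M : nat) :
  (N <= M)%nat -> (forall n, (N < n)%nat -> u n = zero) -> sum_n u M = sum_n u N.
Proof.
  intros HNM Hu. induction HNM as [|M HM IH]; [reflexivity|].
  rewrite sum_Sn, IH, (Hu (S M)) by lia. apply plus_zero_r.
Qed.

Lemma is_series_finite {K : AbsRing} {V : NormedModule K} (u : nat -> V) (N : nat) :
  (forall n, (N < n)%nat -> u n = zero) -> is_series u (sum_n u N).
Proof.
  intros Hu. apply filterlim_ext_loc with (fun _ => sum_n u N).
  - exists N. intros M HM. symmetry. apply sum_n_finite; assumption.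
  - apply filterlim_const.
Qed.

Lemma trunc_le (a : nat -> C) (N n : nat) : (n <= N)%nat -> trunc a N n = a n.
Proof. intros H. unfold trunc. apply Nat.leb_le in H. rewrite H. reflexivity. Qed.

Lemma trunc_gt (a : nat -> C) (N n : nat) : (N < n)%nat -> trunc a N n = 0.
Proof. intros H. unfold trunc. apply Nat.leb_gt in H. rewrite H. reflexivity. Qed.

Lemma tail_trunc_sq (a : nat -> C) (N n : nat) :
  (Cmod (tail a N n) ^ 2 = Cmod (a n) ^ 2 + -1 * Cmod (trunc a N n) ^ 2)%R.
Proof.
  unfold tail. destruct (Nat.le_gt_cases n N) as [H|H].
  - rewrite trunc_le by exact H. replace (a n - a n) with (RtoC 0) by ring.
    rewrite Cmod_0. ring.
  - rewrite trunc_gt by exact H. replace (a n - 0) with (a n) by ring. rewrite Cmod_0. ring.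
Qed.

Lemma has_expansion_poly (a : nat -> C) (N : nat) : has_expansion (poly a N) (trunc a N).
Proof.
  apply has_expansion_series. intros z _.
  replace (poly a N z) with (sum_n (fun n => z ^ n * trunc a N n) N).
  - apply (@is_series_finite C_AbsRing C_NormedModule).
    intros n Hn. rewrite trunc_gt by exact Hn. change (z ^ n * 0 = 0). ring.
  - apply sum_n_ext_loc. intros n Hn. rewrite trunc_le by exact Hn.
    change (z ^ n * a n = a n * z ^ n). ring.
Qed.

Lemma has_expansion_minus (f g : C -> C) (a b : nat -> C) :
  has_expansion f a -> has_expansion g b ->
  has_expansion (fun z => f z - g z) (fun n => a n - b n).
Proof.
  intros Ha Hb. apply has_expansion_series. intros z Hz.
  apply has_expansion_series with (z := z) in Ha, Hb; trivial.
  apply is_series_Cext with (fun n => z ^ n * a n + (- (1)) * (z ^ n * b n)); [intros; ring|].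
  replace (f z - g z) with (f z + (- (1)) * g z) by ring.
  apply is_series_Cplus; [|apply is_series_Cscal]; assumption.
Qed.

Lemma l2_trunc_series (a : nat -> C) (N : nat) :
  is_series (fun n => Cmod (trunc a N n) ^ 2)%R (sum_n (fun n => Cmod (a n) ^ 2)%R N).
Proof.
  rewrite (sum_n_ext_loc _ (fun n => Cmod (trunc a N n) ^ 2)%R).
  - apply (@is_series_finite R_AbsRing R_NormedModule).
    intros n Hn. rewrite trunc_gt by exact Hn. rewrite Cmod_0. change (0 ^ 2 = 0)%R. ring.
  - intros n Hn. rewrite trunc_le by exact Hn. reflexivity.
Qed.

Lemma l2_tail_series (a : nat -> C) (s : R) (N : nat) :
  is_series (fun n => Cmod (a n) ^ 2)%R s ->
  is_series (fun n => Cmod (tail a N n) ^ 2)%R (s - sum_n (fun n => Cmod (a n) ^ 2)%R N)%R.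
Proof.
  intros Hs.
  apply is_series_Rext with (fun n => Cmod (a n) ^ 2 + -1 * Cmod (trunc a N n) ^ 2)%R.
  { intros n. symmetry. apply tail_trunc_sq. }
  replace (s - sum_n (fun n => Cmod (a n) ^ 2)%R N)%R
    with (s + -1 * sum_n (fun n => Cmod (a n) ^ 2)%R N)%R by ring.
  apply is_series_Rplus; [exact Hs|]. apply is_series_Rscal, l2_trunc_series.
Qed.

Lemma H2_le_poly_tail (f : C -> C) (a : nat -> C) (s : R) (N : nat) :
  has_expansion f a -> is_series (fun n => Cmod (a n) ^ 2)%R s ->
  H2_le (fun z => f z - poly a N z) (s - sum_n (fun n => Cmod (a n) ^ 2)%R N).
Proof.
  intros Ha Hs. exists (tail a N). split.
  - apply has_expansion_minus; [exact Ha|apply has_expansion_poly].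
  - apply l2_le_series. eexists. split; [apply l2_tail_series, Hs|apply Rle_refl].
Qed.

Lemma poly_tail (a : nat -> C) (N M : nat) (z : C) :
  (N <= M)%nat -> poly (tail a N) M z = poly a M z - poly a N z.
Proof.
  intros HNM.
  assert (E : poly a N z = poly (trunc a N) M z).
  { unfold poly. rewrite (sum_n_finite (fun n => trunc a N n * z ^ n) N M HNM).
    - apply sum_n_ext_loc. intros n Hn. rewrite trunc_le by exact Hn. reflexivity.
    - intros n Hn. rewrite trunc_gt by exact Hn. change (0 * z ^ n = 0). ring. }
  rewrite E. unfold poly, tail. clear. induction M as [|M IH].
  - rewrite !sum_O. ring.
  - rewrite !sum_Sn, IH.
    change (sum_n (fun n => a n * z ^ n) M - sum_n (fun n => trunc a N n * z ^ n) M
      + (a (S M) - trunc a N (S M)) * z ^ S M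
      = sum_n (fun n => a n * z ^ n) M + a (S M) * z ^ S M
        - (sum_n (fun n => trunc a N n * z ^ n) M + trunc a N (S M) * z ^ S M)).
    ring.
Qed.

Lemma poly_horner (a : nat -> C) (N : nat) (z : C) :
  poly a (S N) z = a 0%nat + z * poly (fun n => a (S n)) N z.
Proof.
  unfold poly. induction N as [|N IH].
  - rewrite sum_Sn, !sum_O. change (a 0%nat * 1 + a 1%nat * (z * 1) = a 0%nat + z * (a 1%nat * 1)).
    ring.
  - rewrite sum_Sn, IH, sum_Sn.
    change (a 0%nat + z * sum_n (fun n => a (S n) * z ^ n) N + a (S (S N)) * (z * z ^ S N)
      = a 0%nat + z * (sum_n (fun n => a (S n) * z ^ n) N + a (S (S N)) * z ^ S N)).
    ring.
Qed.

Lemma sum_n_head (u : nat -> R) (N : nat) :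
  sum_n u (S N) = (u 0%nat + sum_n (fun n => u (S n)) N)%R.
Proof.
  induction N as [|N IH].
  - rewrite sum_Sn, !sum_O. reflexivity.
  - rewrite sum_Sn, IH, sum_Sn. change (u 0%nat + sum_n (fun n => u (S n)) N + u (S (S N))
      = u 0%nat + (sum_n (fun n => u (S n)) N + u (S (S N))))%R. ring.
Qed.

Lemma tail_norm_lim (a : nat -> C) (s : R) :
  is_series (fun n => Cmod (a n) ^ 2)%R s ->
  is_lim_seq (fun N => s - sum_n (fun n => Cmod (a n) ^ 2)%R N)%R 0.
Proof.
  intros Hs. replace (Finite 0) with (Finite (s - s)) by (f_equal; ring).
  apply (is_lim_seq_minus' (fun _ => s)); [apply is_lim_seq_const|exact Hs].
Qed.

Lemma lim_le_zero (x K : R) (e : nat -> R) :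
  (forall N, x <= K * e N)%R -> is_lim_seq e 0 -> (x <= 0)%R.
Proof.
  intros H He.
  assert (Hle : Rbar_le x (K * 0)%R).
  { apply (is_lim_seq_le (fun _ => x) (fun N => K * e N)%R); [exact H| |].
    - apply is_lim_seq_const.
    - apply (is_lim_seq_scal_l e K 0), He. }
  simpl in Hle. lra.
Qed.

(** * Completeness and extension from polynomials *)

Lemma sum_sq_lim (x : nat -> nat -> C) (h : nat -> C) :
  (forall m, is_lim_seq (fun N => Re (x N m)) (Re (h m))) ->
  (forall m, is_lim_seq (fun N => Im (x N m)) (Im (h m))) ->
  forall k, is_lim_seq (fun N => sum_n (fun m => Cmod (x N m) ^ 2)%R k)
                       (sum_n (fun m => Cmod (h m) ^ 2)%R k).
Proof.
  intros HR HI k.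
  assert (Hm : forall m, is_lim_seq (fun N => Cmod (x N m) ^ 2)%R (Cmod (h m) ^ 2)%R).
  { intros m. rewrite Cmod2_alt.
    apply is_lim_seq_ext with (fun N => Re (x N m) * Re (x N m) + Im (x N m) * Im (x N m))%R.
    - intros N. rewrite Cmod2_alt. ring.
    - replace (Re (h m) ^ 2 + Im (h m) ^ 2)%R
        with (Re (h m) * Re (h m) + Im (h m) * Im (h m))%R by ring.
      apply is_lim_seq_plus'; apply is_lim_seq_mult'; auto. }
  induction k as [|k IH].
  - rewrite sum_O. apply is_lim_seq_ext with (fun N => Cmod (x N 0%nat) ^ 2)%R; [|apply Hm].
    intros N. rewrite sum_O. reflexivity.
  - rewrite sum_Sn.
    apply is_lim_seq_ext with
      (fun N => sum_n (fun m => Cmod (x N m) ^ 2)%R k + Cmod (x N (S k)) ^ 2)%R.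
    + intros N. rewrite sum_Sn. reflexivity.
    + apply (is_lim_seq_plus' _ _ _ _ IH (Hm (S k))).
Qed.

Lemma l2_le_lim (x : nat -> nat -> C) (h : nat -> C) (B : R) (N0 : nat) :
  (forall m, is_lim_seq (fun N => Re (x N m)) (Re (h m))) ->
  (forall m, is_lim_seq (fun N => Im (x N m)) (Im (h m))) ->
  (forall N, (N0 <= N)%nat -> l2_le (x N) B) -> l2_le h B.
Proof.
  intros HR HI H k.
  assert (Hle : Rbar_le (sum_n (fun m => Cmod (h m) ^ 2)%R k) B); [|exact Hle].
  apply (is_lim_seq_le_loc (fun N => sum_n (fun m => Cmod (x N m) ^ 2)%R k) (fun _ => B)).
  - exists N0. intros N HN. apply H, HN.
  - apply sum_sq_lim; assumption.
  - apply is_lim_seq_const.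
Qed.

Lemma l2_le_term (a : nat -> C) (B : R) (n : nat) : l2_le a B -> (Cmod (a n) ^ 2 <= B)%R.
Proof.
  intros H. eapply Rle_trans; [|apply (H n)]. destruct n as [|n].
  - rewrite sum_O. apply Rle_refl.
  - rewrite sum_Sn.
    pose proof (sum_n_nonneg (fun k => Cmod (a k) ^ 2)%R n (fun k => Cmod_sq_nonneg (a k))) as H0.
    change (Cmod (a (S n)) ^ 2 <= sum_n (fun k => Cmod (a k) ^ 2) n + Cmod (a (S n)) ^ 2)%R.
    lra.
Qed.

Lemma cauchy_of_modulus (u e : nat -> R) :
  is_lim_seq e 0 -> (forall N M, (N <= M)%nat -> (u M - u N) ^ 2 <= e N)%R ->
  ex_finite_lim_seq u.
Proof.
  intros He H. apply ex_lim_seq_cauchy_corr. intros eps.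
  assert (Heps : (0 < (eps / 2) ^ 2)%R) by (apply pow_lt; pose proof (cond_pos eps); lra).
  destruct (proj2 (is_lim_seq_spec _ _) He (mkposreal _ Heps)) as [N0 HN0].
  specialize (HN0 N0 (Nat.le_refl _)). simpl in HN0.
  assert (HeN : (e N0 < (eps / 2) ^ 2)%R).
  { pose proof (Rle_abs (e N0 - 0)). simpl. lra. }
  assert (Hd : forall N, (N0 <= N)%nat -> (Rabs (u N - u N0) < eps / 2)%R).
  { intros N HN. pose proof (cond_pos eps).
    rewrite <- (Rabs_pos_eq (eps / 2)) by lra. apply Rsqr_lt_abs_0.
    unfold Rsqr. specialize (H N0 N HN). lra. }
  exists N0. intros N M HN HM.
  replace (u N - u M)%R with ((u N - u N0) + - (u M - u N0))%R by ring.
  eapply Rle_lt_trans; [apply Rabs_triang|]. rewrite Rabs_Ropp.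
  pose proof (Hd N HN). pose proof (Hd M HM). lra.
Qed.

Lemma Re_minus (x y : C) : Re (x - y) = (Re x - Re y)%R.
Proof. reflexivity. Qed.

Lemma Im_minus (x y : C) : Im (x - y) = (Im x - Im y)%R.
Proof. reflexivity. Qed.

Lemma l2_complete (x : nat -> nat -> C) (e : nat -> R) :
  is_lim_seq e 0 ->
  (forall N M, (N <= M)%nat -> l2_le (fun m => x M m - x N m) (e N)) ->
  exists h, (forall N, l2_le (fun m => h m - x N m) (e N))
    /\ forall B, (forall N, l2_le (x N) B) -> l2_le h B.
Proof.
  intros He H.
  assert (HcR : forall m, ex_finite_lim_seq (fun N => Re (x N m))).
  { intros m. apply (cauchy_of_modulus _ e He). intros N M HNM.
    eapply Rle_trans; [|apply (l2_le_term _ _ m (H N M HNM))].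
    rewrite Cmod2_alt, Re_minus. pose proof (pow2_ge_0 (Im (x M m - x N m))). lra. }
  assert (HcI : forall m, ex_finite_lim_seq (fun N => Im (x N m))).
  { intros m. apply (cauchy_of_modulus _ e He). intros N M HNM.
    eapply Rle_trans; [|apply (l2_le_term _ _ m (H N M HNM))].
    rewrite Cmod2_alt, Im_minus. pose proof (pow2_ge_0 (Re (x M m - x N m))). lra. }
  set (h := fun m => (real (Lim_seq (fun N => Re (x N m))), real (Lim_seq (fun N => Im (x N m)))) : C).
  assert (HR : forall m, is_lim_seq (fun N => Re (x N m)) (Re (h m))).
  { intros m. apply Lim_seq_correct', HcR. }
  assert (HI : forall m, is_lim_seq (fun N => Im (x N m)) (Im (h m))).
  { intros m. apply Lim_seq_correct', HcI. }
  exists h. split.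
  - intros N. apply (l2_le_lim (fun M m => x M m - x N m) _ _ N).
    + intros m. rewrite Re_minus.
      apply is_lim_seq_ext with (fun M => Re (x M m) - Re (x N m))%R.
      { intros M. rewrite Re_minus. reflexivity. }
      apply is_lim_seq_minus'; [apply HR|apply is_lim_seq_const].
    + intros m. rewrite Im_minus.
      apply is_lim_seq_ext with (fun M => Im (x M m) - Im (x N m))%R.
      { intros M. rewrite Im_minus. reflexivity. }
      apply is_lim_seq_minus'; [apply HI|apply is_lim_seq_const].
    + intros M HM. apply H, HM.
  - intros B HB. apply (l2_le_lim x h B 0 HR HI). intros N _. apply HB.
Qed.

(** A weighted composition operator bounded on polynomials is bounded: the
    images of the Taylor polynomials of [f] form a Cauchy sequence, and its
    limit is [W psi phi f] because point evaluations are continuous. *)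
Lemma H2_le_W_of_poly (psi phi : C -> C) (K : R) :
  (0 <= K)%R -> (forall z, disk z -> disk (phi z)) ->
  (forall N a, H2_le (fun z => psi z * poly a N (phi z))
                     (K * sum_n (fun n => Cmod (a n) ^ 2)%R N)) ->
  forall f B, H2_le f B -> H2_le (W psi phi f) (K * B).
Proof.
  intros HK Hphi Hpoly f B (a & Ha & Hl).
  apply l2_le_series in Hl as (s & Hs & HsB).
  set (S := sum_n (fun n => Cmod (a n) ^ 2)%R).
  assert (HS : forall N, (S N <= s)%R).
  { intros N. apply is_series_partial_le; [intros; apply Cmod_sq_nonneg|exact Hs]. }
  pose proof (tail_norm_lim a s Hs) as Htail.
  set (T := fun N z => psi z * poly a N (phi z)).
  assert (HT : forall N, H2_le (T N) (K * S N)) by (intros N; apply Hpoly).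
  set (x := fun N => coef (T N)).
  assert (Hx : forall N, has_expansion (T N) (x N) /\ l2_le (x N) (K * S N)).
  { intros N. apply H2_le_coef, HT. }
  destruct (l2_complete x (fun N => K * (s - S N))%R) as (h & Hh & HhB).
  { replace (Finite 0) with (Rbar_mult K 0) by (simpl; f_equal; ring).
    apply is_lim_seq_scal_l, Htail. }
  { intros N M HNM. destruct (Hpoly M (tail a N)) as (y & Hy & Hyl).
    apply l2_le_ext with y.
    - apply (has_expansion_unique _ _ _ _) with
        (2 := Hy) (3 := has_expansion_minus _ _ _ _ (proj1 (Hx M)) (proj1 (Hx N))).
      intros z _. unfold T. rewrite poly_tail by exact HNM. ring.
    - apply l2_le_weaken with (2 := Hyl). apply Rmult_le_compat_l; [exact HK|].
      apply is_series_partial_le; [intros; apply Cmod_sq_nonneg|].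
      apply l2_tail_series, Hs. }
  assert (Hhl : l2_le h (K * B)).
  { apply HhB. intros N. apply l2_le_weaken with (2 := proj2 (Hx N)).
    apply Rmult_le_compat_l; [exact HK|]. specialize (HS N). lra. }
  exists h. split; [|exact Hhl].
  apply has_expansion_series. intros z Hz.
  destruct (l2_le_pseries h _ z Hhl Hz) as (l & Hlz & _).
  replace (W psi phi f z) with l; [exact Hlz|].
  assert (Hd : (Cmod (l - W psi phi f z) ^ 2 <= 0)%R).
  { set (p := (/ (1 - Cmod z ^ 2))%R). set (q := (/ (1 - Cmod (phi z) ^ 2))%R).
    apply (lim_le_zero _ (2 * (p * K) + 2 * (Cmod (psi z) ^ 2 * q))%R _) with (2 := Htail).
    intros N.
    replace (l - W psi phi f z)
      with ((l - T N z) + - (psi z * (f (phi z) - poly a N (phi z))))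
      by (unfold W, T; ring).
    eapply Rle_trans; [apply Cmod_plus_sq|].
    rewrite Cmod_opp, Cmod_mult, Rpow_mult_distr.
    pose proof (H2_le_eval _ _ (phi z) (H2_le_poly_tail f a s N Ha Hs) (Hphi z Hz)) as H2.
    fold S q in H2.
    destruct (l2_le_pseries _ _ z (Hh N) Hz) as (l' & Hl' & Hle').
    assert (El : l' = l - T N z).
    { apply (is_series_Cunique _ _ _ Hl').
      apply is_series_Cext with (fun n => z ^ n * h n + (- (1)) * (z ^ n * x N n)); [intros; ring|].
      replace (l - T N z) with (l + (- (1)) * T N z) by ring.
      apply is_series_Cplus; [exact Hlz|]. apply is_series_Cscal.
      exact (proj1 (Hx N) z Hz). }
    rewrite El in Hle'. fold p in Hle'.
    fold S.
    pose proof (Rmult_le_compat_l _ _ _ (Cmod_sq_nonneg (psi z)) H2). lra. }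
  assert (E : l - W psi phi f z = 0).
  { apply Cmod_eq_0. pose proof (Cmod_ge_0 (l - W psi phi f z)). nra. }
  replace l with (l - W psi phi f z + W psi phi f z) by ring. rewrite E. ring.
Qed.

Lemma H2_le_zero : H2_le (fun _ => 0) 0.
Proof.
  destruct (proj1 (H2_H2_le _) (H2_kernel 0 disk_0)) as [B HB].
  apply (H2_le_scal 0) in HB. rewrite Cmod_0 in HB.
  replace (0 ^ 2 * B)%R with 0%R in HB by ring.
  apply H2_le_eq_disk with (2 := HB). intros z _. ring.
Qed.

(** * Littlewood subordination at a zero of the symbol *)

(** Functions vanishing at [v] are orthogonal to the kernel at [v]. *)
Lemma H2_le_kernel_pythagoras (v k : C) (h : C -> C) (B : R) :
  disk v -> H2_le h B -> h v = 0 ->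
  H2_le (fun z => k * kernel v z + h z) (Cmod k ^ 2 * / (1 - Cmod v ^ 2) + B).
Proof.
  intros Hv (b & Hb & Hl) Hhv.
  exists (fun n => k * Cconj v ^ n + b n). split.
  { apply (has_expansion_plus (fun z => k * kernel v z)); [|exact Hb].
    apply has_expansion_scal, has_expansion_kernel, Hv. }
  apply l2_le_series in Hl as (s & Hs & HsB). apply l2_le_series.
  exists (Cmod k ^ 2 * / (1 - Cmod v ^ 2) + s + 2 * Re (Cconj k * 0))%R. split.
  - apply is_series_Rext with (fun n => Cmod k ^ 2 * Cmod (v ^ n) ^ 2 + Cmod (b n) ^ 2
        + 2 * Re (Cconj k * (v ^ n * b n)))%R.
    { intros n. rewrite <- (Cpow_conj v n). set (w := v ^ n). rewrite !Cmod2_alt.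
      destruct k, w, (b n). simpl. ring. }
    apply is_series_Rplus; [apply is_series_Rplus|].
    + apply is_series_Rscal, l2_geom, Hv.
    + exact Hs.
    + apply is_series_Rscal, is_series_Re, is_series_Cscal.
      rewrite <- Hhv. apply (Hb v Hv).
  - replace (Cconj k * 0) with (RtoC 0) by ring. simpl Re. lra.
Qed.

(** Horner's rule [f = f(0) + z g] gives
    [kernel v * f o phi = f(0) kernel v + phi * (kernel v * g o phi)]: the two
    summands are orthogonal because [phi] vanishes at [v], and multiplication by
    [phi] does not increase the norm. *)
Lemma subordination_poly (v : C) (phi : C -> C) :
  disk v -> phi v = 0 ->
  (forall g B, H2_le g B -> H2_le (fun z => phi z * g z) B) ->
  forall N a, H2_le (fun z => kernel v z * poly a N (phi z))
    (/ (1 - Cmod v ^ 2) * sum_n (fun n => Cmod (a n) ^ 2)%R N).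
Proof.
  intros Hv Hphi Hmul. induction N as [|N IH]; intros a.
  - rewrite sum_O. rewrite Rmult_comm.
    apply H2_le_eq_disk with (fun z => a 0%nat * kernel v z + 0).
    { intros z _. unfold poly. rewrite sum_O. simpl. ring. }
    rewrite <- (Rplus_0_r (Cmod (a 0%nat) ^ 2 * _)).
    apply (H2_le_kernel_pythagoras v (a 0%nat) (fun _ => 0)); [exact Hv| |reflexivity].
    exact H2_le_zero.
  - rewrite sum_n_head.
    apply H2_le_eq_disk with (fun z => a 0%nat * kernel v z
        + phi z * (kernel v z * poly (fun n => a (S n)) N (phi z))).
    { intros z _. rewrite poly_horner. ring. }
    replace (/ (1 - Cmod v ^ 2) * (Cmod (a 0%nat) ^ 2 + sum_n (fun n => Cmod (a (S n)) ^ 2) N))%R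
      with (Cmod (a 0%nat) ^ 2 * / (1 - Cmod v ^ 2)
        + / (1 - Cmod v ^ 2) * sum_n (fun n => Cmod (a (S n)) ^ 2) N)%R by ring.
    apply (H2_le_kernel_pythagoras v (a 0%nat)
      (fun z => phi z * (kernel v z * poly (fun n => a (S n)) N (phi z)))); [exact Hv| |].
    + apply Hmul, IH.
    + rewrite Hphi. ring.
Qed.

Lemma H2_le_subordination (v a b c d : C) :
  disk v -> a * d - b * c <> 0 -> lft_self_map a b c d -> lft a b c d v = 0 ->
  forall f B, H2_le f B ->
    H2_le (W (kernel v) (lft a b c d) f) (/ (1 - Cmod v ^ 2) * B).
Proof.
  intros Hv Hdet Hself Hzero. apply H2_le_W_of_poly.
  - left. apply Rinv_0_lt_compat, disk_sq, Hv.
  - intros z Hz. apply (Hself z Hz).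
  - apply subordination_poly; [exact Hv|exact Hzero|].
    intros g B. apply H2_le_mult_lft, lft_self_map_contractive; assumption.
Qed.

(** * Boundedness of the weighted composition operators *)

Lemma disk_aut_det (u r : C) :
  Cmod u = 1%R -> disk r -> - u * 1 - u * r * - Cconj r <> 0.
Proof.
  intros Hu Hr. pose proof (kernel_nz r r Hr Hr) as Hnz.
  assert (Hu0 : u <> 0) by (apply Cmod_gt_0; lra).
  replace (- u * 1 - u * r * - Cconj r) with (- (u * (1 - Cconj r * r))) by ring.
  intros E. apply (Cmult_neq_0 u _ Hu0 Hnz).
  replace (u * (1 - Cconj r * r)) with (- - (u * (1 - Cconj r * r))) by ring.
  rewrite E. ring.
Qed.

Lemma disk_aut_self_map (u r : C) :
  Cmod u = 1%R -> disk r -> lft_self_map (- u) (u * r) (- Cconj r) 1.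
Proof.
  intros Hu Hr z Hz. pose proof (kernel_nz r z Hr Hz) as Hnz.
  replace (- Cconj r * z + 1) with (1 - Cconj r * z) by ring.
  split; [exact Hnz|]. unfold disk, lft.
  replace (- Cconj r * z + 1) with (1 - Cconj r * z) by ring.
  replace (- u * z + u * r) with (u * (r - z)) by ring.
  rewrite Cmod_div, Cmod_mult, Hu, Rmult_1_l by exact Hnz.
  apply Cmod_gt_0 in Hnz.
  apply Rmult_lt_reg_r with (Cmod (1 - Cconj r * z)); [exact Hnz|].
  unfold Rdiv. rewrite Rmult_assoc, Rinv_l by lra. rewrite Rmult_1_r, Rmult_1_l.
  assert (E : (Cmod (1 - Cconj r * z) ^ 2 - Cmod (r - z) ^ 2
     = (1 - Cmod r ^ 2) * (1 - Cmod z ^ 2))%R).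
  { rewrite !Cmod2_alt. destruct r, z. simpl. ring. }
  pose proof (Rmult_lt_0_compat _ _ (disk_sq r Hr) (disk_sq z Hz)).
  pose proof (Cmod_ge_0 (r - z)). nra.
Qed.

Lemma disk_aut_zero (u r : C) : lft (- u) (u * r) (- Cconj r) 1 r = 0.
Proof.
  unfold lft. replace (- u * r + u * r) with (RtoC 0) by ring.
  unfold Cdiv. ring.
Qed.

(** With [s = phi 0] and [tau] the involutive automorphism exchanging [0] and
    [s], the map [phi0 = tau o phi] fixes the origin and [phi = tau o phi0].
    Subordination applies to both factors, at their zeros [s] and [0], and
    what remains of the weight is the inverse of the denominator of [phi0]. *)
Lemma H2_le_W_lft (a b c d : C) :
  a * d - b * c <> 0 -> lft_self_map a b c d ->
  exists K, (0 <= K)%R /\ forall f B, H2_le f B ->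
    H2_le (W (fun z => d / (c * z + d)) (lft a b c d) f) (K * B).
Proof.
  intros Hdet Hself.
  destruct (Hself 0 disk_0) as [Hd Hs].
  replace (c * 0 + d) with d in Hd by ring.
  set (s := b / d).
  assert (Es : lft a b c d 0 = s).
  { unfold lft, s. f_equal; ring. }
  rewrite Es in Hs.
  assert (Esd : s * d = b) by (unfold s; field; exact Hd).
  pose proof (kernel_nz s s Hs Hs) as Hss.
  set (tau := lft (- (1)) (1 * s) (- Cconj s) 1).
  pose proof (disk_aut_self_map 1 s Cmod_1 Hs) as Htau.
  set (c0 := c - Cconj s * a). set (d0 := d - Cconj s * b).
  set (phi0 := lft (s * c - a) 0 c0 d0).
  assert (Hden : forall z, disk z ->
    c0 * z + d0 = (c * z + d) * (1 - Cconj s * lft a b c d z)).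
  { intros z Hz. destruct (Hself z Hz) as [Hnz _]. unfold c0, d0, lft. field. exact Hnz. }
  assert (Hden_nz : forall z, disk z -> 1 - Cconj s * lft a b c d z <> 0).
  { intros z Hz. destruct (Hself z Hz) as [_ Hphi]. apply kernel_nz; assumption. }
  assert (Hphi0 : forall z, disk z -> phi0 z = tau (lft a b c d z)).
  { intros z Hz. destruct (Hself z Hz) as [Hnz _]. pose proof (Hden_nz z Hz) as Hnz'.
    unfold phi0, lft at 1. rewrite (Hden z Hz).
    unfold tau, lft at 2.
    replace (- Cconj s * lft a b c d z + 1) with (1 - Cconj s * lft a b c d z) by ring.
    transitivity ((s - lft a b c d z) / (1 - Cconj s * lft a b c d z)); [|f_equal; ring].
    replace ((s * c - a) * z + 0) with ((c * z + d) * (s - lft a b c d z)).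
    - field. split; assumption.
    - unfold lft, s. field. split; assumption. }
  assert (Hself0 : lft_self_map (s * c - a) 0 c0 d0).
  { intros z Hz. destruct (Hself z Hz) as [Hnz Hphi]. split.
    - rewrite (Hden z Hz). apply Cmult_neq_0; [exact Hnz|apply Hden_nz, Hz].
    - change (disk (phi0 z)). rewrite (Hphi0 z Hz). apply Htau, Hphi. }
  assert (Hdet0 : (s * c - a) * d0 - 0 * c0 <> 0).
  { apply Cmod_gt_0.
    replace ((s * c - a) * d0 - 0 * c0)
      with (- ((a * d - b * c) * (1 - Cconj s * s)))
      by (unfold d0, c0; rewrite <- Esd; ring).
    rewrite Cmod_opp. apply Cmod_gt_0, Cmult_neq_0; assumption. }
  destruct (lft_self_map_contractive _ _ _ _ Hdet0 Hself0) as [Hcd0 _].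
  set (k := d * (1 - Cconj s * s)).
  set (e := (Cmod d0 - Cmod c0)%R) in *.
  assert (He : (0 < e)%R) by (unfold e; lra).
  exists (Cmod k ^ 2 * / e ^ 2 * / (1 - Cmod s ^ 2))%R. split.
  { repeat apply Rmult_le_pos; [apply Cmod_ge_0|apply Cmod_ge_0|lra| |].
    - left. apply Rinv_0_lt_compat, pow_lt, He.
    - left. apply Rinv_0_lt_compat, disk_sq, Hs. }
  intros f B Hf.
  pose proof (H2_le_subordination s _ _ _ _ Hs (disk_aut_det 1 s Cmod_1 Hs) Htau
    (disk_aut_zero 1 s) f B Hf) as H1.
  pose proof (H2_le_subordination 0 _ _ _ _ disk_0 Hdet0 Hself0
    ltac:(unfold lft; replace ((s * c - a) * 0 + 0) with (RtoC 0) by ring; unfold Cdiv; ring)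
    _ _ H1) as H2.
  apply (H2_le_div_linear c0 d0) in H2; [|exact Hcd0].
  apply (H2_le_scal k) in H2.
  eapply H2_le_weaken; [|eapply H2_le_eq_disk; [|exact H2]].
  - fold e. rewrite Cmod_0.
    replace (1 - 0 ^ 2)%R with 1%R by ring. rewrite Rinv_1. right. field.
    pose proof (disk_sq s Hs). lra.
  - intros z Hz. unfold W. fold phi0. fold tau.
    destruct (Hself z Hz) as [Hnz _]. pose proof (Hden_nz z Hz) as Hnz'.
    rewrite (Hden z Hz), (Hphi0 z Hz).
    set (y := lft a b c d z) in *.
    assert (Ety : tau y = (s - y) / (1 - Cconj s * y)).
    { unfold tau, lft. f_equal; ring. }
    assert (Hk : kernel s (tau y) = (1 - Cconj s * y) / (1 - Cconj s * s)).
    { unfold kernel. rewrite Ety. field. split; [|exact Hnz'].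
      replace (1 - Cconj s * y - Cconj s * (s - y)) with (1 - Cconj s * s) by ring.
      exact Hss. }
    assert (Htt : tau (tau y) = y).
    { rewrite Ety. unfold tau, lft. field. split; [exact Hnz'|].
      replace (- Cconj s * (s - y) + (1 - Cconj s * y)) with (1 - Cconj s * s) by ring.
      exact Hss. }
    rewrite Hk, Htt. unfold k, kernel.
    replace (Cconj 0) with (RtoC 0) by (unfold Cconj; simpl; rewrite Ropp_0; reflexivity).
    field. repeat split; assumption.
Qed.

Lemma W_linear (psi phi : C -> C) (alpha : C) (f g : C -> C) :
  eq_disk (W psi phi (fun z => alpha * f z + g z))
          (fun z => alpha * W psi phi f z + W psi phi g z).
Proof. intros z _. unfold W. ring. Qed.

Lemma bounded_operator_W (psi phi : C -> C) (K : R) :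
  (0 <= K)%R -> (forall f B, H2_le f B -> H2_le (W psi phi f) (K * B)) ->
  bounded_operator (W psi phi).
Proof.
  intros HK H. split; [|split].
  - intros f (B & HB)%H2_H2_le. apply H2_H2_le. eexists. apply H, HB.
  - intros. apply W_linear.
  - exists (sqrt K). intros f Hf. apply norm2_le.
    + apply Rmult_le_pos; [apply sqrt_pos|apply norm2_nonneg].
    + rewrite Rpow_mult_distr, pow2_sqrt by exact HK. apply H, norm2_H2_le, Hf.
Qed.

(** * Adjoints determined on reproducing kernels *)

Lemma inner_eq_disk (f f' g g' : C -> C) :
  H2 f -> H2 g -> eq_disk f f' -> eq_disk g g' -> inner f g = inner f' g'.
Proof.
  intros (A & HA)%H2_H2_le (B & HB)%H2_H2_le Ef Eg.
  pose proof (proj1 (H2_le_coef _ _) HA) as [Hf _].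
  pose proof (proj1 (H2_le_coef _ _) HB) as [Hg _].
  unfold inner. rewrite (coef_eq f' _ (has_expansion_eq_disk _ _ _ Ef Hf)).
  rewrite (coef_eq g' _ (has_expansion_eq_disk _ _ _ Eg Hg)). reflexivity.
Qed.

Lemma inner_antilinear (f g h : C -> C) (k : C) :
  H2 f -> H2 g -> H2 h ->
  inner f (fun z => k * g z + h z) = Cconj k * inner f g + inner f h.
Proof.
  intros (A & HA)%H2_H2_le (B & HB)%H2_H2_le (D & HD)%H2_H2_le.
  destruct (H2_inner_series f g A B HA HB) as [Hg _].
  destruct (H2_inner_series f h A D HA HD) as [Hh _].
  apply H2_le_coef in HA, HB, HD.
  apply (inner_eq _ _ (coef f) (fun n => k * coef g n + coef h n)).
  - apply HA.
  - apply (has_expansion_plus (fun z => k * g z)); [apply has_expansion_scal, HB|apply HD].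
  - apply is_series_Cext with (fun n => Cconj k * (coef f n * Cconj (coef g n))
                                        + coef f n * Cconj (coef h n)).
    { intros n. rewrite Cplus_conj, Cmult_conj. ring. }
    apply is_series_Cplus; [apply is_series_Cscal, Hg|exact Hh].
Qed.

Lemma inner_scal_r (f g : C -> C) (k : C) :
  H2 f -> H2 g -> inner f (fun z => k * g z) = Cconj k * inner f g.
Proof.
  intros (A & HA)%H2_H2_le (B & HB)%H2_H2_le.
  destruct (H2_inner_series f g A B HA HB) as [Hg _].
  apply H2_le_coef in HA, HB.
  apply (inner_eq _ _ (coef f) (fun n => k * coef g n)).
  - apply HA.
  - apply has_expansion_scal, HB.
  - apply is_series_Cext with (fun n => Cconj k * (coef f n * Cconj (coef g n))).
    { intros n. rewrite Cmult_conj. ring. }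
    apply is_series_Cscal, Hg.
Qed.

Lemma Cconj_RtoC (x : R) : Cconj x = x.
Proof. unfold Cconj. simpl. rewrite Ropp_0. reflexivity. Qed.

Lemma inner_kernel (f : C -> C) (w : C) : H2 f -> disk w -> inner f (kernel w) = f w.
Proof.
  intros (A & HA)%H2_H2_le Hw. apply H2_le_coef in HA as [Ha _].
  apply (inner_eq _ _ _ _ _ Ha (has_expansion_kernel w Hw)).
  apply is_series_Cext with (fun n => w ^ n * coef f n); [|apply (Ha w Hw)].
  intros n. rewrite <- Cpow_conj, Cconj_conj. ring.
Qed.

Lemma is_series_of_remainder (u : nat -> C) (l : C) (K : R) (e : nat -> R) :
  is_lim_seq e 0 -> (forall N, Cmod (l - sum_n u N) ^ 2 <= K * e N)%R -> is_series u l.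
Proof.
  intros He H.
  assert (key : forall (v : nat -> R) (x : R),
    (forall N, (x - v N) ^ 2 <= K * e N)%R -> is_lim_seq v x).
  { intros v x Hv. apply is_lim_seq_spec. intros eps.
    assert (Heps : (0 < eps ^ 2)%R) by (apply pow_lt, cond_pos).
    assert (Hlim : is_lim_seq (fun N => K * e N)%R 0).
    { replace (Finite 0) with (Rbar_mult K 0) by (simpl; f_equal; ring).
      apply is_lim_seq_scal_l, He. }
    destruct (proj2 (is_lim_seq_spec _ _) Hlim (mkposreal _ Heps)) as [N0 HN0].
    exists N0. intros N HN. specialize (HN0 N HN). simpl in HN0.
    pose proof (Rle_abs (K * e N - 0)). specialize (Hv N). pose proof (cond_pos eps).
    rewrite <- (Rabs_pos_eq eps) by lra. apply Rsqr_lt_abs_0. unfold Rsqr. lra. }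
  apply is_series_Re_Im; apply key; intros N; (eapply Rle_trans; [|apply (H N)]);
    rewrite Cmod2_alt, Re_minus, Im_minus, sum_n_pair; unfold Re, Im; simpl fst; simpl snd.
  - rewrite <- Rplus_0_r at 1.
    apply Rplus_le_compat; [apply Rle_refl|apply pow2_ge_0].
  - rewrite <- Rplus_0_l at 1.
    apply Rplus_le_compat; [apply pow2_ge_0|apply Rle_refl].
Qed.

Lemma H2_poly (a : nat -> C) (N : nat) : H2 (poly a N).
Proof.
  apply H2_H2_le. eexists. exists (trunc a N). split; [apply has_expansion_poly|].
  apply l2_le_series. eexists. split; [apply l2_trunc_series|apply Rle_refl].
Qed.

Lemma H2_monomial (n : nat) : H2 (fun z => z ^ n).
Proof.
  destruct (proj1 (H2_H2_le _) (H2_poly (fun k => if (k =? n)%nat then 1 else 0) n)) as [B HB].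
  apply H2_H2_le. exists B. apply H2_le_eq_disk with (2 := HB).
  intros z _. unfold poly. destruct n as [|n].
  - rewrite sum_O. simpl. ring.
  - rewrite sum_Sn, Nat.eqb_refl.
    rewrite (sum_n_ext_loc _ (fun _ => zero)).
    + rewrite (sum_n_finite (fun _ : nat => zero) 0 n) by (auto with arith).
      rewrite sum_O. change (0 + 1 * z ^ S n = z ^ S n). ring.
    + intros k Hk. replace (k =? S n)%nat with false.
      * change (0 * z ^ k = 0). ring.
      * symmetry. apply Nat.eqb_neq. lia.
Qed.

(** The remainder of the series is the inner product of [f] with the image of a
    Taylor tail of [g], and is small by Cauchy-Schwarz. *)
Lemma inner_W_series (f : C -> C) (psi phi : C -> C) (K : R) :
  H2 f -> (forall g B, H2_le g B -> H2_le (W psi phi g) (K * B)) ->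
  forall g b, H2 g -> has_expansion g b ->
    is_series (fun n => Cconj (b n) * inner f (W psi phi (fun z => z ^ n)))
              (inner f (W psi phi g)).
Proof.
  intros Hf HW g b Hg Hb.
  assert (HWH : forall h, H2 h -> H2 (W psi phi h)).
  { intros h (B & HB)%H2_H2_le. apply H2_H2_le. eexists. apply HW, HB. }
  assert (Hlin : forall k h h', H2 h -> H2 h' ->
     inner f (W psi phi (fun z => k * h z + h' z))
     = Cconj k * inner f (W psi phi h) + inner f (W psi phi h')).
  { intros k h h' Hh Hh'. rewrite <- inner_antilinear by auto.
    apply inner_eq_disk; [exact Hf| |intros z _; reflexivity|apply W_linear].
    apply HWH, H2_lincomb; assumption. }
  assert (Hsum : forall N,
     sum_n (fun n => Cconj (b n) * inner f (W psi phi (fun z => z ^ n))) N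
     = inner f (W psi phi (poly b N))).
  { induction N as [|N IH].
    - rewrite sum_O, <- inner_scal_r by (try exact Hf; apply HWH, H2_monomial).
      f_equal. apply functional_extensionality. intros z. unfold W, poly.
      rewrite sum_O. ring.
    - rewrite sum_Sn, IH.
      transitivity (inner f (W psi phi (fun z => b (S N) * z ^ S N + poly b N z))).
      + rewrite (Hlin (b (S N)) (fun z => z ^ S N) (poly b N));
          [apply Cplus_comm|apply H2_monomial|apply H2_poly].
      + f_equal. apply functional_extensionality. intros z. unfold W, poly.
        rewrite sum_Sn. f_equal. apply Cplus_comm. }
  apply H2_H2_le in Hf as (A & HA). pose proof Hg as (B & HB)%H2_H2_le.
  apply H2_le_coef in HB as [_ Hl]. rewrite (coef_eq g b Hb) in Hl.
  apply l2_le_series in Hl as (s & Hs & _).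
  apply (is_series_of_remainder _ _ (A * K) _ (tail_norm_lim b s Hs)).
  intros N. rewrite Hsum.
  pose proof (HW _ _ (H2_le_poly_tail g b s N Hb Hs)) as Htail.
  replace (inner f (W psi phi g) - inner f (W psi phi (poly b N)))
    with (inner f (W psi phi (fun z => g z - poly b N z))).
  - rewrite Rmult_assoc. apply H2_inner_series; assumption.
  - transitivity (inner f (W psi phi (fun z => - (1) * poly b N z + g z))).
    + f_equal. apply functional_extensionality. intros z. unfold W. ring.
    + rewrite Hlin; [|apply H2_poly|exact Hg].
      rewrite Copp_conj, Cconj_RtoC. ring.
Qed.

(** Expanding [inner f (S (kernel v)) = W psi phi f v] in powers of [v] shows
    that the numbers [inner f (S z^n)] are the Taylor coefficients of
    [W psi phi f]. *)
Lemma is_adjoint_W (psi phi psis phis : C -> C) (K : R) :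
  (0 <= K)%R -> (forall z, disk z -> disk (phi z)) ->
  (forall g B, H2_le g B -> H2_le (W psis phis g) (K * B)) ->
  (forall v, disk v ->
     eq_disk (W psis phis (kernel v)) (fun z => Cconj (psi v) * kernel (phi v) z)) ->
  is_adjoint (W psi phi) (W psis phis).
Proof.
  intros HK Hphi HS Hker. split; [exact (bounded_operator_W _ _ K HK HS)|].
  intros f g Hf Hg.
  assert (Hexp : has_expansion (W psi phi f)
     (fun n => inner f (W psis phis (fun z => z ^ n)))).
  { apply has_expansion_series. intros v Hv.
    pose proof (H2_kernel v Hv) as Hkv.
    pose proof (inner_W_series f psis phis K Hf HS _ _ Hkv (has_expansion_kernel v Hv)) as H.
    replace (inner f (W psis phis (kernel v))) with (W psi phi f v) in H.
    - apply is_series_Cext with (2 := H). intros n.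
      rewrite <- Cpow_conj, Cconj_conj. reflexivity.
    - pose proof (H2_kernel (phi v) (Hphi v Hv)) as Hkphi.
      transitivity (inner f (fun z => Cconj (psi v) * kernel (phi v) z)).
      + rewrite inner_scal_r, inner_kernel, Cconj_conj by auto. reflexivity.
      + symmetry. apply inner_eq_disk; [exact Hf| |intros z _; reflexivity|exact (Hker v Hv)].
        apply (proj1 (bounded_operator_W _ _ K HK HS)), Hkv. }
  pose proof Hg as (b & _ & Hb).
  apply (inner_eq _ _ _ _ _ Hexp Hb).
  apply is_series_Cext with (2 := inner_W_series f psis phis K Hf HS g b Hg Hb).
  intros n. apply Cmult_comm.
Qed.

(** * The conjugation and the symmetry *)

Lemma has_expansion_J (f : C -> C) :
  H2 f -> has_expansion (J f) (fun n => Cconj (coef f n))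
    /\ eq_disk (J f) (fun z => Cconj (f (Cconj z))).
Proof.
  intros (B & HB)%H2_H2_le. apply H2_le_coef in HB as [Hf _].
  assert (key : forall z, disk z ->
    is_series (fun n => z ^ n * Cconj (coef f n)) (Cconj (f (Cconj z)))).
  { intros z Hz.
    apply is_series_Cext with (fun n => Cconj (Cconj z ^ n * coef f n)).
    - intros n. rewrite Cmult_conj, Cpow_conj, Cconj_conj. reflexivity.
    - apply is_series_Cconj, (Hf (Cconj z) (disk_conj z Hz)). }
  assert (E : eq_disk (J f) (fun z => Cconj (f (Cconj z)))).
  { intros z Hz. apply CSeries_eq.
    apply is_series_Cext with (2 := key z Hz). intros n. apply Cmult_comm. }
  split; [|exact E].
  apply has_expansion_series. intros z Hz. rewrite (E z Hz). apply key, Hz.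
Qed.

Lemma H2_le_J (f : C -> C) (B : R) : H2_le f B -> H2_le (J f) B.
Proof.
  intros H. pose proof (proj2 (H2_H2_le f) (ex_intro _ B H)) as Hf.
  exists (fun n => Cconj (coef f n)). split; [apply has_expansion_J, Hf|].
  apply l2_le_conj, H2_le_coef, H.
Qed.

(** Contractivity is enough for isometry, an involution being its own inverse. *)
Lemma conjugation_of_contraction (A : operator) :
  (forall f B, H2_le f B -> H2_le (A f) B) ->
  (forall (alpha : C) f g, H2 f -> H2 g ->
     eq_disk (A (fun z => alpha * f z + g z))
             (fun z => Cconj alpha * A f z + A g z)) ->
  (forall f, H2 f -> eq_disk (A (A f)) f) ->
  conjugation A.
Proof.
  intros HA Hlin Hinv.
  assert (HAH : forall f, H2 f -> H2 (A f)).
  { intros f (B & HB)%H2_H2_le. apply H2_H2_le. exists B. apply HA, HB. }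
  assert (Hle : forall f, H2 f -> (norm2 (A f) <= norm2 f)%R).
  { intros f Hf. apply norm2_le; [apply norm2_nonneg|]. apply HA, norm2_H2_le, Hf. }
  repeat split; try assumption.
  intros f Hf. apply Rle_antisym; [apply Hle, Hf|].
  eapply Rle_trans; [|apply (Hle (A f) (HAH f Hf))].
  apply norm2_le; [apply norm2_nonneg|].
  apply H2_le_eq_disk with (1 := Hinv f Hf). apply norm2_H2_le, HAH, HAH, Hf.
Qed.

Definition aut_conjugation (r : C) : operator :=
  fun f => J (W (normalized_kernel r) (sigma_map r) f).

Lemma Cconj_nz (z : C) : z <> 0 -> Cconj z <> 0.
Proof. intros Hz. apply Cmod_gt_0. rewrite Cmod_conj. apply Cmod_gt_0, Hz. Qed.

Lemma sigma_map_lft (r z : C) :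
  sigma_map r z = lft (- (Cconj r / r)) (Cconj r / r * r) (- Cconj r) 1 z.
Proof.
  unfold sigma_map, lft. replace (- Cconj r * z + 1) with (1 - Cconj r * z) by ring.
  unfold Cdiv. ring.
Qed.

Lemma Cmod_conj_div (r : C) : r <> 0 -> Cmod (Cconj r / r) = 1%R.
Proof.
  intros Hr. rewrite Cmod_div, Cmod_conj by exact Hr.
  apply Cmod_gt_0 in Hr. field. lra.
Qed.

Lemma sigma_map_disk (r z : C) : r <> 0 -> disk r -> disk z -> disk (sigma_map r z).
Proof.
  intros Hr0 Hr Hz. rewrite sigma_map_lft.
  apply (disk_aut_self_map _ _ (Cmod_conj_div r Hr0) Hr z Hz).
Qed.

Lemma H2_le_W_sigma (r : C) (f : C -> C) (B : R) :
  r <> 0 -> disk r -> H2_le f B -> H2_le (W (normalized_kernel r) (sigma_map r) f) B.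
Proof.
  intros Hr0 Hr Hf.
  pose proof (Cmod_conj_div r Hr0) as Hu.
  pose proof (H2_le_subordination r _ _ _ _ Hr (disk_aut_det _ r Hu Hr)
    (disk_aut_self_map _ r Hu Hr) (disk_aut_zero _ r) f B Hf) as H.
  apply (H2_le_scal (sqrt (1 - Cmod r ^ 2))) in H.
  pose proof (disk_sq r Hr) as Hpos.
  apply (H2_le_weaken _ _ B) in H.
  - apply H2_le_eq_disk with (2 := H). intros z _.
    unfold W. rewrite sigma_map_lft. unfold normalized_kernel, kernel, Cdiv. ring.
  - rewrite Cmod_R, pow2_abs, pow2_sqrt by lra.
    right. field. lra.
Qed.

Lemma aut_conjugation_eq (r : C) (f : C -> C) :
  r <> 0 -> disk r -> H2 f ->
  eq_disk (aut_conjugation r f)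
    (fun z => Cconj (normalized_kernel r (Cconj z) * f (sigma_map r (Cconj z)))).
Proof.
  intros Hr0 Hr (B & HB)%H2_H2_le.
  apply has_expansion_J, H2_H2_le. exists B. apply H2_le_W_sigma; assumption.
Qed.

Lemma normalization_sq (r : C) :
  disk r -> RtoC (sqrt (1 - Cmod r ^ 2)) * RtoC (sqrt (1 - Cmod r ^ 2)) = 1 - Cconj r * r.
Proof.
  intros Hr. rewrite <- RtoC_mult, sqrt_sqrt by (left; apply disk_sq, Hr).
  rewrite RtoC_minus, Cmod2_conj. ring.
Qed.

Lemma conjugation_aut (r : C) : r <> 0 -> disk r -> conjugation (aut_conjugation r).
Proof.
  intros Hr0 Hr.
  assert (HA : forall f B, H2_le f B -> H2_le (aut_conjugation r f) B).
  { intros f B Hf. apply H2_le_J, H2_le_W_sigma; assumption. }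
  apply conjugation_of_contraction; [exact HA| |].
  - intros alpha f g Hf Hg z Hz.
    rewrite !aut_conjugation_eq by (trivial; apply H2_lincomb; assumption).
    rewrite <- Cmult_conj, <- Cplus_conj. f_equal. ring.
  - intros f Hf z Hz.
    assert (HAf : H2 (aut_conjugation r f)).
    { apply H2_H2_le in Hf as (B & HB). apply H2_H2_le. exists B. apply HA, HB. }
    pose proof (disk_conj z Hz) as Hz'.
    pose proof (sigma_map_disk r _ Hr0 Hr Hz') as Hs.
    rewrite (aut_conjugation_eq r _ Hr0 Hr HAf z Hz).
    rewrite (aut_conjugation_eq r f Hr0 Hr Hf _ Hs).
    rewrite Cmult_conj, Cconj_conj.
    pose proof (Cconj_nz r Hr0) as Hrc.
    pose proof (kernel_nz r r Hr Hr) as Hrr.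
    pose proof (kernel_nz r _ Hr Hz') as Hnz.
    assert (Hnz' : 1 - r * z <> 0).
    { apply Cconj_nz in Hnz.
      rewrite Cminus_conj, Cmult_conj, !Cconj_conj, Cconj_RtoC in Hnz. exact Hnz. }
    assert (Ey : Cconj (sigma_map r (Cconj z)) = r / Cconj r * ((Cconj r - z) / (1 - r * z))).
    { unfold sigma_map.
      rewrite Cmult_conj, !Cdiv_conj, !Cminus_conj, Cmult_conj, !Cconj_conj, Cconj_RtoC
        by assumption.
      reflexivity. }
    rewrite Ey. set (y := r / Cconj r * ((Cconj r - z) / (1 - r * z))).
    assert (E1 : 1 - Cconj r * y = (1 - Cconj r * r) / (1 - r * z)).
    { unfold y. field. split; assumption. }
    assert (E2 : sigma_map r y = z).
    { unfold sigma_map. rewrite E1. unfold y. field. repeat split; assumption. }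
    rewrite E2.
    unfold normalized_kernel. rewrite E1, Cdiv_conj, Cconj_RtoC by exact Hnz.
    rewrite Cminus_conj, Cmult_conj, !Cconj_conj, Cconj_RtoC.
    set (q := RtoC (sqrt (1 - Cmod r ^ 2))).
    transitivity (q * q / (1 - Cconj r * r) * f z).
    + field. split; assumption.
    + unfold q. rewrite normalization_sq by exact Hr. field. exact Hrr.
Qed.

(** The fixed point gives [(a - d) eta = c eta^2 - b], and with it the condition
    on [p] becomes the single linear equation under which [phi] and [sigma]
    intertwine. *)
Lemma intertwining_relation (a b c d eta p : C) :
  c * eta + d <> 0 -> circle eta -> lft a b c d eta = eta ->
  b * p * (Cconj p - 1) = c * eta ^ 2 * Cconj p * (p - 1) ->
  let r := p * Cconj eta in
  a * r * Cconj r + b * r = c * Cconj r + r * Cconj r * d.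
Proof.
  intros Hnz Heta Hfix Hcond r.
  assert (He : eta * Cconj eta = 1).
  { rewrite <- Cmod2_conj. unfold circle in Heta. rewrite Heta. f_equal. ring. }
  assert (Ef : (a - d) * eta = c * eta ^ 2 - b).
  { assert (H : a * eta + b = eta * (c * eta + d)).
    { rewrite <- Hfix at 2. unfold lft. field. exact Hnz. }
    transitivity (a * eta + b - d * eta - b); [ring|]. rewrite H. ring. }
  assert (Hr : Cconj r = Cconj p * eta).
  { unfold r. rewrite Cmult_conj, Cconj_conj. reflexivity. }
  rewrite Hr. unfold r.
  (* the difference of the two sides is [conj eta] times a combination of the
     two hypotheses *)
  assert (E : a * (p * Cconj eta) * (Cconj p * eta) + b * (p * Cconj eta)
      - (c * (Cconj p * eta) + p * Cconj eta * (Cconj p * eta) * d)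
    = p * Cconj p * Cconj eta * ((a - d) * eta) + b * p * Cconj eta
      - c * Cconj p * eta * 1) by ring.
  rewrite <- He, Ef in E.
  assert (E' : p * Cconj p * Cconj eta * (c * eta ^ 2 - b) + b * p * Cconj eta
      - c * Cconj p * eta * (eta * Cconj eta)
    = Cconj eta * (c * eta ^ 2 * Cconj p * (p - 1) - b * p * (Cconj p - 1))) by ring.
  rewrite E', Hcond in E.
  set (L := a * (p * Cconj eta) * (Cconj p * eta) + b * (p * Cconj eta)) in *.
  set (M := c * (Cconj p * eta) + p * Cconj eta * (Cconj p * eta) * d) in *.
  transitivity (L - M + M); [ring|]. rewrite E. ring.
Qed.

(** The two denominators [(1 - conj r x) (c sigma(x) + d)] and
    [(- b x + d) (1 - conj r y)], with [y = (a x - c) / (- b x + d)], are the same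
    polynomial, and so are the numerators: the matrix of [phi] times that of [sigma]
    equals the matrix of [sigma] times that of [x -> y]. *)
Lemma intertwining (a b c d r x : C) :
  r <> 0 -> Cconj r <> 0 ->
  a * r * Cconj r + b * r = c * Cconj r + r * Cconj r * d ->
  1 - Cconj r * x <> 0 -> - b * x + d <> 0 -> c * sigma_map r x + d <> 0 ->
  let y := (a * x - c) / (- b * x + d) in
  lft a b c d (sigma_map r x) = sigma_map r y /\
  normalized_kernel r x * (d / (c * sigma_map r x + d))
  = d / (- b * x + d) * normalized_kernel r y.
Proof.
  intros Hr Hrc Hrel Hx Hbd Hcd y.
  set (q := Cconj r) in *.
  set (D := c * (q / r) * (r - x) + d * (1 - q * x)).
  set (N := a * (q / r) * (r - x) + b * (1 - q * x)).
  assert (Hb : b = (c * q + r * q * d - a * r * q) / r).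
  { rewrite <- Hrel. field. exact Hr. }
  assert (Es : sigma_map r x = q / r * ((r - x) / (1 - q * x))) by reflexivity.
  assert (ED : c * sigma_map r x + d = D / (1 - q * x)).
  { rewrite Es. unfold D. field. split; assumption. }
  assert (EN : a * sigma_map r x + b = N / (1 - q * x)).
  { rewrite Es. unfold N. field. split; assumption. }
  assert (EyD : 1 - q * y = D / (- b * x + d)).
  { transitivity ((- b * x + d - q * (a * x - c)) / (- b * x + d)).
    - unfold y. field. exact Hbd.
    - f_equal. unfold D. rewrite Hb. field. exact Hr. }
  assert (EyN : q / r * (r - y) = N / (- b * x + d)).
  { transitivity (q / r * (r * (- b * x + d) - (a * x - c)) / (- b * x + d)).
    - unfold y. field. split; assumption.
    - f_equal. unfold N. rewrite Hb. field. exact Hr. }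
  assert (HD : D <> 0).
  { intros E. apply Hcd. rewrite ED, E. unfold Cdiv. ring. }
  split.
  - unfold lft. rewrite ED, EN. unfold sigma_map. fold q. rewrite EyD.
    transitivity (q / r * (r - y) / (D / (- b * x + d))); [|unfold Cdiv; ring].
    rewrite EyN. field. repeat split; assumption.
  - unfold normalized_kernel. fold q. rewrite ED, EyD.
    field. repeat split; assumption.
Qed.

Lemma kernel_adjoint_weight (a b c d z : C) :
  d <> 0 -> c * z + d <> 0 ->
  kernel (lft (Cconj a) (- Cconj c) (- Cconj b) (Cconj d) 0) z = d / (c * z + d).
Proof.
  intros Hd Hz.
  assert (E : Cconj (lft (Cconj a) (- Cconj c) (- Cconj b) (Cconj d) 0) = - c / d).
  { unfold lft.
    replace (Cconj a * 0 + - Cconj c) with (- Cconj c) by ring.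
    replace (- Cconj b * 0 + Cconj d) with (Cconj d) by ring.
    rewrite Cdiv_conj, Copp_conj, !Cconj_conj by (apply Cconj_nz, Hd). reflexivity. }
  unfold kernel. rewrite E. field. split; assumption.
Qed.

(** Both sides equal [conj d] divided by
    [conj d - conj b w - conj v (conj a w - conj c)]. *)
Lemma adjoint_on_kernel (a b c d v w : C) :
  disk v -> disk w ->
  c * v + d <> 0 -> disk (lft a b c d v) ->
  - Cconj b * w + Cconj d <> 0 ->
  disk (lft (Cconj a) (- Cconj c) (- Cconj b) (Cconj d) w) ->
  Cconj d / (- Cconj b * w + Cconj d)
    * kernel v (lft (Cconj a) (- Cconj c) (- Cconj b) (Cconj d) w)
  = Cconj (d / (c * v + d)) * kernel (lft a b c d v) w.
Proof.
  intros Hv Hw Hcv Hphiv Hbw Hphiw.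
  pose proof (kernel_nz v _ Hv Hphiw) as Hk.
  assert (Hcv' : Cconj c * Cconj v + Cconj d <> 0).
  { apply Cconj_nz in Hcv. rewrite Cplus_conj, Cmult_conj in Hcv. exact Hcv. }
  unfold kernel. rewrite Cdiv_conj, Cplus_conj, Cmult_conj by exact Hcv.
  set (D := - Cconj b * w + Cconj d - Cconj v * (Cconj a * w - Cconj c)).
  assert (E1 : 1 - Cconj v * lft (Cconj a) (- Cconj c) (- Cconj b) (Cconj d) w
               = D / (- Cconj b * w + Cconj d)).
  { unfold lft, D. field. exact Hbw. }
  assert (E2 : 1 - Cconj (lft a b c d v) * w = D / (Cconj c * Cconj v + Cconj d)).
  { unfold lft, D. rewrite Cdiv_conj, !Cplus_conj, !Cmult_conj by exact Hcv.
    field. exact Hcv'. }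
  assert (HD : D <> 0).
  { intros E. apply Hk. rewrite E1, E. unfold Cdiv. ring. }
  rewrite E1, E2. field. repeat split; assumption.
Qed.

Theorem theorem5 (a b c d eta p : C)
    (Hdet : a * d - b * c <> 0)
    (Hbc : Cmod b = Cmod c)
    (Hself : lft_self_map a b c d)
    (Heta : circle eta)
    (Hfix : lft a b c d eta = eta)
    (Hp : disk p)
    (Hp0 : p <> 0)
    (Hcond : b * p * (Cconj p - 1) = c * eta ^ 2 * Cconj p * (p - 1)) :
  let phi := lft a b c d in
  let phistar := lft (Cconj a) (- Cconj c) (- Cconj b) (Cconj d) in
  let psi := kernel (phistar 0) in
  let r := p * Cconj eta in
  complex_symmetric (W psi phi) (fun f => J (W (normalized_kernel r) (sigma_map r) f)).
Proof.
  intros phi phistar psi r.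
  change (complex_symmetric (W psi phi) (aut_conjugation r)).
  destruct (lft_self_map_contractive a b c d Hdet Hself) as [Hcd _].
  assert (Hd : d <> 0).
  { apply Cmod_gt_0. pose proof (Cmod_ge_0 c). lra. }
  assert (Hnz_eta : c * eta + d <> 0).
  { apply linear_nz; [exact Hcd|]. unfold circle in Heta. lra. }
  assert (Hr : disk r).
  { unfold disk, r. rewrite Cmod_mult, Cmod_conj. unfold circle in Heta.
    rewrite Heta, Rmult_1_r. exact Hp. }
  assert (Hr0 : r <> 0).
  { apply Cmult_neq_0; [exact Hp0|]. apply Cconj_nz, Cmod_gt_0.
    unfold circle in Heta. lra. }
  pose proof (Cconj_nz r Hr0) as Hrc.
  pose proof (intertwining_relation a b c d eta p Hnz_eta Heta Hfix Hcond) as Hrel.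
  fold r in Hrel. cbv zeta in Hrel.
  assert (Hpsi : forall z, disk z -> psi z = d / (c * z + d)).
  { intros z Hz. apply kernel_adjoint_weight; [exact Hd|apply (Hself z Hz)]. }
  pose proof (lft_self_map_adjoint a b c d Hdet Hself) as Hself'.
  assert (Hdet' : Cconj a * Cconj d - - Cconj c * - Cconj b <> 0).
  { apply Cconj_nz in Hdet. rewrite Cminus_conj, !Cmult_conj in Hdet.
    replace (Cconj a * Cconj d - - Cconj c * - Cconj b)
      with (Cconj a * Cconj d - Cconj b * Cconj c) by ring. exact Hdet. }
  destruct (H2_le_W_lft a b c d Hdet Hself) as (K & HK & HT).
  destruct (H2_le_W_lft _ _ _ _ Hdet' Hself') as (K' & HK' & HS).
  fold phistar in HS. fold phi in HT.
  set (psis := fun z => Cconj d / (- Cconj b * z + Cconj d)) in HS.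
  assert (HT' : forall f B, H2_le f B -> H2_le (W psi phi f) (K * B)).
  { intros f B Hf. apply H2_le_eq_disk with (2 := HT f B Hf).
    intros z Hz. unfold W. rewrite (Hpsi z Hz). reflexivity. }
  pose proof (bounded_operator_W _ _ K HK HT') as HTb.
  pose proof (conjugation_aut r Hr0 Hr) as HA.
  split; [exact HTb|]. split; [exact HA|].
  exists (W psis phistar). split.
  - apply (is_adjoint_W _ _ _ _ K' HK'); [|exact HS|].
    + intros z Hz. apply (Hself z Hz).
    + intros v Hv w Hw. unfold W, psis. rewrite (Hpsi v Hv).
      destruct (Hself v Hv) as [Hcv Hphiv]. destruct (Hself' w Hw) as [Hbw Hphiw].
      apply adjoint_on_kernel; assumption.
  - intros f Hf z Hz.
    assert (HTf : H2 (W psi phi f)) by (apply (proj1 HTb), Hf).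
    rewrite (aut_conjugation_eq r _ Hr0 Hr HTf z Hz).
    unfold W at 2.
    destruct (Hself' z Hz) as [Hbz Hpz]. fold phistar in Hpz.
    rewrite (aut_conjugation_eq r f Hr0 Hr Hf _ Hpz).
    pose proof (disk_conj z Hz) as Hx. set (x := Cconj z) in *.
    assert (Hbx : - b * x + d <> 0).
    { apply Cconj_nz in Hbz.
      rewrite Cplus_conj, Cmult_conj, Copp_conj, !Cconj_conj in Hbz. exact Hbz. }
    pose proof (sigma_map_disk r x Hr0 Hr Hx) as Hsx.
    destruct (Hself _ Hsx) as [Hcs _].
    pose proof (kernel_nz r x Hr Hx) as Hkx.
    destruct (intertwining a b c d r x Hr0 Hrc Hrel Hkx Hbx Hcs) as [E1 E2].
    set (y := (a * x - c) / (- b * x + d)) in *.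
    assert (Ey : Cconj (phistar z) = y).
    { unfold phistar, lft, y. rewrite Cdiv_conj by exact Hbz.
      rewrite !Cplus_conj, !Cmult_conj, !Copp_conj, !Cconj_conj. reflexivity. }
    rewrite Ey.
    assert (Eps : psis z = Cconj (d / (- b * x + d))).
    { unfold psis, x. rewrite Cdiv_conj by exact Hbx.
      rewrite Cplus_conj, Cmult_conj, Copp_conj. unfold x. rewrite Cconj_conj. reflexivity. }
    rewrite Eps, <- Cmult_conj. f_equal.
    unfold W, phi. rewrite (Hpsi _ Hsx), E1, !Cmult_assoc, E2. reflexivity.
Qed.
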